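(* There is a reduction from SAT on nondeterministic branching programs to Edit Distance, and likewise to Longest Common Subsequence (LCS), on binary sequences, with the following guarantee. Given a nondeterministic branching program $P$ on $n$ Boolean variables, of length $T$ and width $W$, one can construct in $O(N)$ time two binary sequences $x,y \in \{0,1\}^{N}$ with $N = 2^{n/2}\cdot T^{O(\log W)}$, together with an integer threshold, such that whether $P$ is satisfiable (i.e. accepts some input in $\{0,1\}^n$) can be read off by comparing the Edit Distance of $x,y$ (respectively, the length of a longest common subsequence of $x,y$) with that threshold.
   Context: A nondeterministic branching program (BP) of length $T$ and width $W$ on Boolean inputs $x_1,\dots,x_n$ is a layered directed graph with layers $L_1,\dots,L_T$; the nodes are $(i,j)$ with $i\in[T]$ the layer and $j\in[W]$. The start node is $u_{\texttt{start}}=(1,1)$ and the accept node is $u_{\texttt{acc}}=(T,1)$. Every layer $i<T$ is labelled with a variable $x_{f(i)}$, and nodes of $L_i$ have arbitrarily many outgoing edges to layer $L_{i+1}$, each labelled $0$ or $1$. On input $x\in\{0,1\}^n$, an edge leaving layer $i$ is usable iff its label equals $x_{f(i)}$; the BP accepts $x$ iff $u_{\texttt{acc}}$ is reachable from $u_{\texttt{start}}$ using usable edges. BP-SAT asks whether some input is accepted. The Edit Distance of two sequences is the minimum number of insertions, deletions and substitutions transforming one into the other; LCS is the length of a longest sequence that is a subsequence of both. *)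

(* Defs.v *)
From HB Require Import structures.
From mathcomp Require Import all_boot all_order all_algebra.
From mathcomp Require Import all_classical all_reals all_analysis.

Set Implicit Arguments.
Unset Strict Implicit.
Unset Printing Implicit Defensive.

(* A nondeterministic branching program on [n] Boolean variables, of length [T]
   and width [W].  Layers and nodes are numbered from 0, so the labelled layers
   are 0, ..., T - 2.  [bp_edge P i j b j'] says that there is an edge labelled
   [b] from node [(i, j)] to node [(i + 1, j')]. *)
Record bp (n T W : nat) := BP {
  bp_var : 'I_T.-1 -> 'I_n;
  bp_edge : 'I_T.-1 -> 'I_W -> bool -> 'I_W -> bool }.

Definition bp_node (T W : nat) : finType := ('I_T * 'I_W)%type.

Definition bp_usable (n T W : nat) (P : bp n T W) (x : n.-tuple bool) :
    rel (bp_node T W) :=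
  fun u v => [exists i : 'I_T.-1,
    [&& u.1 == i :> nat, v.1 == i.+1 :> nat
      & bp_edge P i u.2 (tnth x (bp_var P i)) v.2]].

(* The start and accept nodes exist only for positive length and width. *)
Definition bp_start (T W : nat) : bp_node T.+1 W.+1 := (ord0, ord0).
Definition bp_acc (T W : nat) : bp_node T.+1 W.+1 := (ord_max, ord0).

Definition bp_accepts (n T W : nat) (P : bp n T.+1 W.+1) (x : n.-tuple bool) :
    bool :=
  connect (bp_usable P x) (bp_start T W) (bp_acc T W).

Definition bp_sat (n T W : nat) (P : bp n T.+1 W.+1) : Prop :=
  exists x : n.-tuple bool, bp_accepts P x.

Inductive edit_step (A : Type) : seq A -> seq A -> Prop :=
| edit_ins s1 a s2 : edit_step (s1 ++ s2) (s1 ++ a :: s2)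
| edit_del s1 a s2 : edit_step (s1 ++ a :: s2) (s1 ++ s2)
| edit_sub s1 a b s2 : edit_step (s1 ++ a :: s2) (s1 ++ b :: s2).

Inductive edits (A : Type) : nat -> seq A -> seq A -> Prop :=
| edits0 s : edits 0 s s
| editsS k s t u : edit_step s t -> edits k t u -> edits k.+1 s u.

Lemma edits_ex (A : Type) (s t : seq A) : exists k, `[< edits k s t >].
Proof.
suff: exists k, edits k s t by case=> k ?; exists k; apply/asboolP.
elim: s => [|a s [k IHs]]; last first.
  by exists k.+1; apply: editsS IHs; apply: (@edit_del A [::]).
suff H u : exists k, edits k u (u ++ t) by exact: (H [::]).
elim: t u => [|b t IHt] u; first by exists 0; rewrite cats0; apply: edits0.
have [k Hk] := IHt (rcons u b); exists k.+1; rewrite -cat_rcons.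
apply: editsS Hk; rewrite -{1}[u]cats0 -cats1; exact: edit_ins.
Qed.

Definition edit_distance (A : Type) (s t : seq A) : nat :=
  ex_minn (edits_ex s t).

(* A common subsequence has length at most [size s]. *)
Definition lcs (A : finType) (s t : seq A) : nat :=
  \max_(k < (size s).+1 |
        [exists z : k.-tuple A, subseq z s && subseq z t]) k.

(* Machine model for running times: a first-order call-by-value functional
   language over binary trees, with general recursion and unit cost for each
   evaluation step.  A fixed program in it is simulated on a word RAM (or a
   pointer machine) with constant-factor overhead: a tree is a pointer to an
   immutable cell, and the only primitives are building a cell, testing for
   [Leaf], and following the two pointers of a cell.  So a time bound in this
   model implies the same asymptotic bound on a word RAM. *)
Inductive tree := Leaf | Node of tree & tree.

(* [EVar i] is a de Bruijn index; [ECase e e0 e1] binds two variables in [e1],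
   the left (index 0) and right (index 1) subtrees; [ELet] binds one; [ECall f e]
   applies the [f]-th function of the program to one argument. *)
Inductive expr :=
| EVar of nat
| ELeaf
| ENode of expr & expr
| ECase of expr & expr & expr
| ELet of expr & expr
| ECall of nat & expr.

(* The bodies of mutually recursive unary functions, each with its argument as
   variable 0; function 0 is the entry point. *)
Definition program := seq expr.

(* [eval p env e v k]: in environment [env], [e] evaluates to [v] in [k] steps. *)
Inductive eval (p : program) : seq tree -> expr -> tree -> nat -> Prop :=
| eval_var env i v : onth env i = Some v -> eval p env (EVar i) v 1
| eval_leaf env : eval p env ELeaf Leaf 1
| eval_node env e1 e2 v1 v2 k1 k2 :
    eval p env e1 v1 k1 -> eval p env e2 v2 k2 ->
    eval p env (ENode e1 e2) (Node v1 v2) (k1 + k2).+1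
| eval_case_leaf env e e0 e1 v k1 k2 :
    eval p env e Leaf k1 -> eval p env e0 v k2 ->
    eval p env (ECase e e0 e1) v (k1 + k2).+1
| eval_case_node env e e0 e1 a b v k1 k2 :
    eval p env e (Node a b) k1 -> eval p [:: a, b & env] e1 v k2 ->
    eval p env (ECase e e0 e1) v (k1 + k2).+1
| eval_let env e1 e2 v1 v k1 k2 :
    eval p env e1 v1 k1 -> eval p (v1 :: env) e2 v k2 ->
    eval p env (ELet e1 e2) v (k1 + k2).+1
| eval_call env f body e v1 v k1 k2 :
    onth p f = Some body ->
    eval p env e v1 k1 -> eval p [:: v1] body v k2 ->
    eval p env (ECall f e) v (k1 + k2).+1.

Lemma eval_det (p : program) env e v k :
  eval p env e v k -> forall v' k', eval p env e v' k' -> v' = v /\ k' = k.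
Proof.
elim=> {env e v k} [env i v Hi|env|env e1 e2 v1 v2 k1 k2 _ IH1 _ IH2
  |env e e0 e1 v k1 k2 _ IH1 _ IH2|env e e0 e1 a b v k1 k2 _ IH1 _ IH2
  |env e1 e2 v1 v k1 k2 _ IH1 _ IH2|env f body e v1 v k1 k2 Hf _ IH1 _ IH2] v' k' H;
  inversion H; subst;
  repeat match goal with
  | IH : context [eval p ?env ?e _ _ -> _ /\ _], H : eval p ?env ?e _ _ |- _ =>
      case: (IH _ _ H) => ? ?; clear H; subst
  | H1 : ?a = Some _, H2 : ?a = Some _ |- _ =>
      rewrite H1 in H2; case: H2 => ?; subst
  | H : Node _ _ = Node _ _ |- _ => case: H => ? ?; subst
  | H : Leaf = Node _ _ |- _ => by []
  | H : Node _ _ = Leaf |- _ => by []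
  end; by [].
Qed.

Definition runs_in (p : program) (input output : tree) (k : nat) : Prop :=
  eval p [:: input] (ECall 0 (EVar 0)) output k.

Definition tree_of_bool (b : bool) : tree := if b then Node Leaf Leaf else Leaf.
Definition tree_of_seq (s : seq tree) : tree := foldr Node Leaf s.
Definition tree_of_bits (s : seq bool) : tree := tree_of_seq (map tree_of_bool s).

(* Unary numbers stay within the O(N) budget: for T, W >= 2,
   n = O(2^(n/2)) and W <= T^(log W), and a nontrivial
   threshold is at most the length of the two sequences. *)
Definition tree_of_nat (m : nat) : tree := tree_of_seq (nseq m Leaf).

(* The parameters n, T, W, then for each labelled layer its variable index and
   its [W * W] adjacency matrix, whose entries are pairs of bits: presence of an
   edge labelled 0, presence of an edge labelled 1. *)
Definition tree_of_bp (n T W : nat) (P : bp n T W) : tree :=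
  let entry i j j' :=
    Node (tree_of_bool (bp_edge P i j false j'))
         (tree_of_bool (bp_edge P i j true j')) in
  let layer i :=
    Node (tree_of_nat (bp_var P i))
         (tree_of_seq [seq tree_of_seq [seq entry i j j' | j' <- enum 'I_W]
                      | j <- enum 'I_W]) in
  Node (tree_of_nat n) (Node (tree_of_nat T) (Node (tree_of_nat W)
    (tree_of_seq [seq layer i | i <- enum 'I_T.-1]))).

Definition tree_of_instance (x y : seq bool) (t : nat) : tree :=
  Node (tree_of_bits x) (Node (tree_of_bits y) (tree_of_nat t)).

(* [good x y t] is the answer read off from sequences [x], [y] and threshold
   [t]; [N n T W] is the length of the sequences built from a branching program
   on [n] variables, of length [T] and width [W].  Since the exponent
   O(log W) is meaningless at W = 1, the logarithm is that of [maxn 2 W]. *)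
Definition bp_sat_reduces_to (R : realType)
    (good : seq bool -> seq bool -> nat -> Prop) : Prop :=
  exists (p : program) (N : nat -> nat -> nat -> nat) (c C : nat),
    (forall n T W : nat, (0 < T)%N -> (0 < W)%N ->
      ((N n T W)%:R <= 2 `^ (n%:R / 2)
         * T%:R `^ (C%:R * (ln (maxn 2 W)%:R / ln 2)) :> R)%R) /\
    (forall (n T W : nat) (P : bp n T.+1 W.+1),
      exists (x y : (N n T.+1 W.+1).-tuple bool) (t k : nat),
        [/\ runs_in p (tree_of_bp P) (tree_of_instance x y t) k,
            (k <= c * N n T.+1 W.+1)%N
          & bp_sat P <-> good x y t]).

(* Main.v *)
(* LCS and edit distance are both maximum alignment scores with match score
   [beta + 1] and mismatch score [beta], for [beta = 0] and [beta = 1].  The score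
   is measured relative to aligning [x] inside an endless run of zeros, so that
   unused parts of [x] cost nothing once the second sequence has long enough runs
   of zeros to absorb them.

   On a pair of half assignments the branching program is a list of pairs of boolean
   matrices (one known to each side), and acceptance is a Savitch formula: an OR
   over the middle node of the AND of two formulas of half the depth.  A gadget of
   one level is made from those of the level below.  The second string lists all
   the subgadgets between runs of ones, separated by runs of zeros; the first has
   one group for each middle node, with its two subgadgets at the matching
   positions and zeros elsewhere.  Counting zeros forces a group that keeps its
   end markers to align each subgadget with its counterpart.

   For the OR over all pairs, each first string also contains a null slot, whose
   gain on any second string is exactly one less than that of a satisfied pair.
   With [N] second strings the gain is therefore at most [N] times the null gain if
   no pair accepts, and a suitable shift of the list gains one more if some pair
   does.

   The reduction enumerates half assignments by a binary recursion that carries, for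
   each layer, the number of variables left before its own, so that no time is
   spent comparing variable indices. *)

Require Import Defs.
From HB Require Import structures.
From mathcomp Require Import all_boot all_order all_algebra.
From mathcomp Require Import all_classical all_reals all_analysis.
From mathcomp Require Import zify lra.
Set Implicit Arguments.
Unset Strict Implicit.
Unset Printing Implicit Defensive.

(** * Counting zeros and ones in binary strings *)

Notation zeros := (count negb).
Notation ones := (count id).
Notation rep0 n := (nseq n false).
Notation rep1 n := (nseq n true).

Lemma zeros_rep0 n : zeros (rep0 n) = n. Proof. by rewrite count_nseq mul1n. Qed.
Lemma ones_rep0 n : ones (rep0 n) = 0. Proof. by rewrite count_nseq mul0n. Qed.
Lemma zeros_rep1 n : zeros (rep1 n) = 0. Proof. by rewrite count_nseq mul0n. Qed.
Lemma ones_rep1 n : ones (rep1 n) = n. Proof. by rewrite count_nseq mul1n. Qed.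
Definition count_repE := (count_cat, zeros_rep0, ones_rep0, zeros_rep1, ones_rep1).

Lemma zerosD_ones s : zeros s + ones s = size s.
Proof. by rewrite addnC -(count_predC id s). Qed.

(** Two cuts of one string are comparable. The upper bounds below locate the pieces of an alignment
    relative to the parts of the second string by repeated use of this dichotomy. *)
Lemma cat_eq_cat (A : Type) (s1 s2 t1 t2 : seq A) : s1 ++ s2 = t1 ++ t2 ->
  (exists r, t1 = s1 ++ r /\ s2 = r ++ t2) \/
  (exists r, s1 = t1 ++ r /\ t2 = r ++ s2).
Proof.
elim: s1 t1 => [|a s1 IH] [|b t1] /=.
- by move=> ->; left; exists [::].
- by move=> ->; left; exists (b :: t1).
- by move=> <-; right; exists (a :: s1).
case=> <- /IH [[r [-> ->]]|[r [-> ->]]]; [left|right]; by exists r.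
Qed.

(** * Alignments *)

Section Alignment.
Variable beta : nat.

(* [g] counts the ones of [x] matched with ones, and [l] is what is lost with respect
   to matching every zero of [x] and substituting every one: the score of the
   alignment is [(beta + 1) * zeros x + beta * ones x + g - l]. *)
Inductive align : seq bool -> seq bool -> nat -> nat -> Prop :=
| align_nil : align [::] [::] 0 0
| align_del a x y g l : align x y g l -> align (a :: x) y g (l + (beta + ~~ a))
| align_ins c x y g l : align x y g l -> align x (c :: y) g l
| align_pair a c x y g l :
    align x y g l -> align (a :: x) (c :: y) (g + (a && c)) (l + (~~ a && c)).

Lemma align_eq x y g l g' l' :
  align x y g l -> g = g' -> l = l' -> align x y g' l'.
Proof. by move=> H <- <-. Qed.

Lemma align_cat x1 y1 g1 l1 x2 y2 g2 l2 :
  align x1 y1 g1 l1 -> align x2 y2 g2 l2 ->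
  align (x1 ++ x2) (y1 ++ y2) (g1 + g2) (l1 + l2).
Proof.
move=> H H2; elim: H => {x1 y1 g1 l1} [|a x y g l _ IH|c x y g l _ IH|a c x y g l _ IH] //=.
- by rewrite addnAC; apply: align_del.
- exact: align_ins.
- by rewrite addnAC (addnAC l); apply: align_pair.
Qed.

Lemma align_splitx x1 x2 y g l : align (x1 ++ x2) y g l ->
  exists y1 y2 g1 g2 l1 l2, [/\ y = y1 ++ y2, align x1 y1 g1 l1,
    align x2 y2 g2 l2, g = g1 + g2 & l = l1 + l2].
Proof.
move Ex: (x1 ++ x2) => x H; elim: H x1 Ex => {x y g l}
  [|a x y g l H IH|c x y g l H IH|a c x y g l H IH] x1 Ex.
- case: x1 Ex => // Ex; exists [::], [::], 0, 0, 0, 0; split=> //=; try exact: align_nil.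
  by move: Ex => /= ->; apply: align_nil.
- case: x1 Ex => [/= ->|b x1 [-> /IH]].
    by exists [::], y, 0, g, 0, (l + (beta + ~~ a)); split; rewrite ?add0n //;
       [apply: align_nil|apply: align_del].
  move=> [y1 [y2 [g1 [g2 [l1 [l2 [-> H1 H2 -> ->]]]]]]].
  exists y1, y2, g1, g2, (l1 + (beta + ~~ a)), l2; split=> //; last by rewrite addnAC.
  exact: align_del.
- have [y1 [y2 [g1 [g2 [l1 [l2 [-> H1 H2 -> ->]]]]]]] := IH _ Ex.
  by exists (c :: y1), y2, g1, g2, l1, l2; split=> //; apply: align_ins.
- case: x1 Ex => [/= ->|b x1 [-> /IH]].
    exists [::], (c :: y), 0, (g + (a && c)), 0, (l + (~~ a && c)).
    by split; rewrite ?add0n //; [apply: align_nil|apply: align_pair].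
  move=> [y1 [y2 [g1 [g2 [l1 [l2 [-> H1 H2 -> ->]]]]]]].
  exists (c :: y1), y2, (g1 + (a && c)), g2, (l1 + (~~ a && c)), l2.
  by split=> //; [apply: align_pair|rewrite addnAC|rewrite addnAC].
Qed.

Lemma align_splity x y1 y2 g l : align x (y1 ++ y2) g l ->
  exists x1 x2 g1 g2 l1 l2, [/\ x = x1 ++ x2, align x1 y1 g1 l1,
    align x2 y2 g2 l2, g = g1 + g2 & l = l1 + l2].
Proof.
move Ey: (y1 ++ y2) => y H; elim: H y1 Ey => {x y g l}
  [|a x y g l H IH|c x y g l H IH|a c x y g l H IH] y1 Ey.
- case: y1 Ey => // Ey; exists [::], [::], 0, 0, 0, 0; split=> //=; try exact: align_nil.
  by move: Ey => /= ->; apply: align_nil.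
- have [x1 [x2 [g1 [g2 [l1 [l2 [-> H1 H2 -> ->]]]]]]] := IH _ Ey.
  exists (a :: x1), x2, g1, g2, (l1 + (beta + ~~ a)), l2; split=> //; last by rewrite addnAC.
  exact: align_del.
- case: y1 Ey => [/= ->|b y1 [-> /IH]].
    by exists [::], x, 0, g, 0, l; split; rewrite ?add0n //;
       [apply: align_nil|apply: align_ins].
  move=> [x1 [x2 [g1 [g2 [l1 [l2 [-> H1 H2 -> ->]]]]]]].
  by exists x1, x2, g1, g2, l1, l2; split=> //; apply: align_ins.
- case: y1 Ey => [/= ->|b y1 [-> /IH]].
    exists [::], (a :: x), 0, (g + (a && c)), 0, (l + (~~ a && c)).
    by split; rewrite ?add0n //; [apply: align_nil|apply: align_pair].
  move=> [x1 [x2 [g1 [g2 [l1 [l2 [-> H1 H2 -> ->]]]]]]].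
  exists (a :: x1), x2, (g1 + (a && c)), g2, (l1 + (~~ a && c)), l2.
  by split=> //; [apply: align_pair|rewrite addnAC|rewrite addnAC].
Qed.

Lemma align_skip y : align [::] y 0 0.
Proof. by elim: y => [|c y IH]; [apply: align_nil|apply: align_ins]. Qed.

Lemma align_widen x u y v g l : align x y g l -> align x (u ++ y ++ v) g l.
Proof.
move=> H; rewrite -[g]addn0 -[l]addn0 -(cats0 x).
by apply: (align_cat (align_skip u)); apply: (align_cat H); apply: align_skip.
Qed.

Lemma align_gain_x x y g l : align x y g l -> g <= ones x.
Proof. by elim=> {x y g l} /= *; lia. Qed.

Lemma align_gain_y x y g l : align x y g l -> g <= ones y.
Proof. by elim=> {x y g l} /= *; lia. Qed.

Lemma align_loss x y g l : align x y g l -> ones x = 0 -> size x <= zeros y + l.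
Proof. elim=> {x y g l} //= [[] x y g l|c x y g l|[] c x y g l] _ IH //= ?; lia. Qed.

Lemma align_rep0_loss p y g l : align (rep0 p) y g l -> p <= zeros y + l.
Proof. by move/align_loss; rewrite ones_rep0 size_nseq => ->. Qed.

Lemma align_rep0_le p y : p <= zeros y -> align (rep0 p) y 0 0.
Proof.
elim: y p => [|c y IH] [|p] //=; try by move=> _; apply: align_skip.
case: c => /= lep; first by apply/align_ins/(IH p.+1).
by apply: (align_eq (align_pair false false (IH p lep))).
Qed.

(** Substituting a one by a zero is the baseline of the score, so a long run of zeros takes any
    string at no cost. *)
Lemma align_absorb x K : size x <= K -> align x (rep0 K) 0 0.
Proof.
elim: x K => [|a x IH] [|K] //=; try by move=> _; apply: align_skip.
by move=> /IH H; apply: (align_eq (align_pair a false H)); rewrite ?andbF.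
Qed.

Lemma align_rep1 k : align (rep1 k) (rep1 k) k 0.
Proof.
elim: k => [|k IH]; first exact: align_nil.
by apply: (align_eq (align_pair true true IH)); lia.
Qed.

Lemma align_del_rep0 r : align (rep0 r) [::] 0 (r * beta.+1).
Proof.
elim: r => [|r IH]; first exact: align_nil.
by apply: (align_eq (align_del false IH)) => //=; lia.
Qed.

(** This bounds the net gain [g - l] without subtraction. Quantifying over the zero padding lets the
    bound pass to infixes of [x]: what is cut off is absorbed by extra zeros. *)
Definition upper x y h :=
  forall K K' g l, align x (rep0 K ++ y ++ rep0 K') g l -> g <= h + l.

Lemma upper_infix x y h K K' u v C g l : upper x y h ->
  rep0 K ++ y ++ rep0 K' = u ++ C ++ v -> align x C g l -> g <= h + l.
Proof. by move=> H E /(align_widen u v); rewrite -E; apply: H. Qed.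

Lemma upper_le x y h h' : upper x y h -> h <= h' -> upper x y h'.
Proof. move=> H le K K' g l /H; lia. Qed.

Lemma upper_pad x y h K K' : upper x y h -> upper x (rep0 K ++ y ++ rep0 K') h.
Proof.
by move=> H J J' g l; rewrite -!catA catA -nseqD -nseqD; apply: H.
Qed.

Lemma upper_ones x y : upper x y (ones x).
Proof. move=> K K' g l /align_gain_x; lia. Qed.

Lemma upper_infixx x y h u v : upper (u ++ x ++ v) y h -> upper x y h.
Proof.
move=> H K K' g l A.
have := align_cat (align_absorb (leqnn (size u))) (align_cat A (align_absorb (leqnn (size v)))).
rewrite !catA -nseqD -!catA -nseqD addn0 add0n => /H; lia.
Qed.

(* If the markers [rep1 k] are not dropped, a subgadget [x1] or [x2] outside the
   window of its counterpart leaves too few zeros of the second string for the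
   runs [rep0 p], [rep0 k], [rep0 p'] on one of its sides. *)
Lemma upper_group x1 x2 y1 y2 L R h1 h2 k p p' :
  upper x1 y1 h1 -> upper x2 y2 h2 ->
  ones x1 + ones x2 <= k ->
  zeros L + zeros y1 + ones x1 + ones x2 <= p ->
  zeros R + zeros y2 + ones x1 + ones x2 <= p' ->
  upper (rep1 k ++ rep0 p ++ x1 ++ rep0 k ++ x2 ++ rep0 p' ++ rep1 k)
    (rep1 k ++ L ++ rep0 k ++ y1 ++ rep0 k ++ y2 ++ rep0 k ++ R ++ rep1 k)
    (k + k + h1 + h2).
Proof.
move=> H1 H2 lek lep lep' K K' g l.
case/align_splitx=> A [? [gA [? [lA [? [EA HA H Eg El]]]]]].
case/align_splitx: H => B [? [gB [? [lB [? [? HB H ? ?]]]]]].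
case/align_splitx: H => C1 [? [gC1 [? [lC1 [? [? HC1 H ? ?]]]]]].
case/align_splitx: H => M [? [gM [? [lM [? [? HM H ? ?]]]]]].
case/align_splitx: H => C2 [? [gC2 [? [lC2 [? [? HC2 H ? ?]]]]]].
case/align_splitx: H => D [F [gD [gF [lD [lF [? HD HF ? ?]]]]]]; subst.
have := align_gain_x HA; have := align_gain_x HB; have := align_gain_x HC1.
have := align_gain_x HM; have := align_gain_x HC2; have := align_gain_x HD.
have := align_gain_x HF; rewrite !count_repE => gF1 gD1 gC21 gM1 gC11 gB1 gA1.
have gA2 := align_gain_y HA; have gF2 := align_gain_y HF.
have LB := align_rep0_loss HB; have LM := align_rep0_loss HM.
have LD := align_rep0_loss HD.
have Z s t : s = t -> zeros s = zeros t by move=> ->.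
(* If the window of the opening marker lies in the outer padding, the marker gains nothing, and by
   [lek] the missing [k] covers both subgadgets. The closing marker is treated alike. *)
case: (cat_eq_cat EA) => [[A' [_ E1]]|[r [/(congr1 ones) E _]]]; last first.
  by move: E; rewrite !count_repE; lia.
have {}E1 : (rep1 k ++ L ++ rep0 k ++ y1 ++ rep0 k ++ y2 ++ rep0 k ++ R ++ rep1 k)
   ++ rep0 K' = (A' ++ B ++ C1 ++ M ++ C2 ++ D) ++ F by rewrite -!catA -E1 -!catA.
case: (cat_eq_cat E1) => [[r [_ /(congr1 ones) E]]|[r [E2 EF]]].
  by move: E; rewrite !count_repE; lia.
have {}E2' : (rep1 k ++ L) ++ (rep0 k ++ y1 ++ rep0 k ++ y2 ++ rep0 k ++ R ++ rep1 k)
  = (A' ++ B) ++ (C1 ++ M ++ C2 ++ D ++ r).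
  by move: E2; rewrite -!catA.
case: (cat_eq_cat E2') => [[E3 [EAB E4]]|[s [/Z E _]]]; last first.
  by move: E; rewrite !count_repE; lia.
have {}E4' : (rep0 k ++ y1 ++ rep0 k ++ y2 ++ rep0 k) ++ (R ++ rep1 k)
  = (E3 ++ C1 ++ M ++ C2) ++ (D ++ r) by rewrite -!catA.
case: (cat_eq_cat E4') => [[s [_ /Z E]]|[E5 [EC ED]]].
  by move: E; rewrite !count_repE; lia.
have ZAB := Z _ _ EAB; have ZD := Z _ _ ED; rewrite !count_repE in ZAB ZD.
have {}EC1 : (rep0 k ++ y1 ++ rep0 k) ++ (y2 ++ rep0 k)
  = (E3 ++ C1) ++ (M ++ C2 ++ E5) by rewrite -!catA EC -!catA.
(* If [C1] ends at or after the start of [y2], at most [k + zeros y2] zeros remain for [M] and [E5],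
   and the losses on the middle and right runs cancel both subgadgets. The next cut is symmetric. *)
case: (cat_eq_cat EC1) => [[s [_ /Z E]]|[r1 [EC1' _]]].
  by move: E; rewrite !count_repE; lia.
have {}EC2 : (rep0 k ++ y1) ++ (rep0 k ++ y2 ++ rep0 k)
  = (E3 ++ C1 ++ M) ++ (C2 ++ E5) by rewrite -!catA EC -!catA.
case: (cat_eq_cat EC2) => [[r2 [_ EC2']]|[s [/Z E _]]]; last first.
  by move: E; rewrite !count_repE; lia.
rewrite -!catA in EC1' EC2'.
have := upper_infix H1 EC1' HC1.
have := upper_infix H2 EC2' HC2.
lia.
Qed.

(* Aligning two of the [F i] with parts of [y] costs the whole run between them. *)
Lemma upper_flatten (I : Type) (F : I -> seq bool) kap y h s : size y <= kap ->
  (forall i, List.In i s -> upper (F i) y h) ->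
  upper (flatten [seq F i ++ rep0 kap | i <- s]) y h.
Proof.
move=> lek; elim: s => [|i s IH] H K K' g l /=.
  by move/align_gain_x => /=; lia.
have {}IH := IH (fun j Hj => H j (or_intror Hj)).
have {}H := H i (or_introl erefl).
rewrite -catA; case/align_splitx=> A [? [gA [? [lA [? [EA HA HBC Eg El]]]]]].
case/align_splitx: HBC => B [C [gB [gC [lB [lC [? HB HC ? ?]]]]]]; subst.
have gA2 := align_gain_y HA; have gC2 := align_gain_y HC.
have gB1 := align_gain_x HB; have LB := align_rep0_loss HB.
rewrite ones_rep0 in gB1.
have EC : rep0 K ++ y ++ rep0 K' = (A ++ B) ++ C ++ [::] by rewrite cats0 -catA.
have hA := upper_infix H (u := [::]) EA HA; have hC := upper_infix IH EC HC.
case: (cat_eq_cat EA) => [[A' [EA' E1]]|[r [/(congr1 ones) E _]]]; last first.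
  by move: E; rewrite !count_repE; lia.
have {}E1 : y ++ rep0 K' = (A' ++ B) ++ C by rewrite -catA.
case: (cat_eq_cat E1) => [[r [_ /(congr1 ones) E]]|[C' [Ey EC']]].
  by move: E; rewrite !count_repE; lia.
have := zerosD_ones y; move: gA2 gC2; rewrite EA' EC' {1 2}Ey !count_repE; lia.
Qed.

(** If the marker [rep1 q] meets no one, its missing [q] outweighs [x]. If the window of [x] starts
    after [rep1 q'], the bound [h] applies. Otherwise the run [rep0 k] meets no zero, and its loss
    outweighs [x]. *)
Lemma upper_null x y h q q' k : upper x y h -> ones x <= q -> ones x <= k ->
  upper (rep1 q ++ rep0 k ++ x) (rep1 q' ++ rep0 k ++ y) (q + h).
Proof.
move=> H leq lek K K' g l.
case/align_splitx=> A [? [gA [? [lA [? [EA HA HBC Eg El]]]]]].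
case/align_splitx: HBC => B [C [gB [gC [lB [lC [? HB HC ? ?]]]]]]; subst.
have gA1 := align_gain_x HA; have gA2 := align_gain_y HA.
have gB1 := align_gain_x HB; have gC1 := align_gain_x HC.
have LB := align_rep0_loss HB; rewrite !count_repE in gB1 gA1.
case: (cat_eq_cat EA) => [[A' [EA' E1]]|[r [/(congr1 ones) E _]]]; last first.
  by move: E; rewrite !count_repE; lia.
have {}E1 : rep1 q' ++ ((rep0 k ++ y) ++ rep0 K') = (A' ++ B) ++ C.
  by rewrite -!catA -E1 -!catA.
case: (cat_eq_cat E1) => [[r [E2 E3]]|[r [/(congr1 zeros) E _]]]; last first.
  by move: E; rewrite !count_repE; lia.
have {}E3 : rep0 k ++ y ++ rep0 K' = r ++ C ++ [::] by rewrite cats0 -E3 -catA.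
have := upper_infix H E3 HC; lia.
Qed.

(** Cutting along the second string leaves each block with an infix of [x], for which the bound of
    the whole [x] still holds by [upper_infixx]. *)
Lemma upper_blocks (I : Type) (F : I -> seq bool) sg h s x :
  (forall i, List.In i s -> upper x (F i) h) ->
  upper x (flatten [seq rep0 sg ++ F i ++ rep0 sg | i <- s]) (size s * h).
Proof.
elim: s x => [|i s IH] x H K K' g l /=.
  by move/align_gain_y; rewrite !count_repE; lia.
rewrite -!catA catA -nseqD (catA (F i)) (catA (rep0 _)).
case/align_splity=> x1 [x2 [g1 [g2 [l1 [l2 [Ex H1 H2 -> ->]]]]]].
have U1 : upper x1 (F i) h.
  by apply: (@upper_infixx x1 (F i) h [::] x2); rewrite /= -Ex; apply: H; left.
have U2 : upper x2 (flatten [seq rep0 sg ++ F i ++ rep0 sg | i <- s]) (size s * h).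
  apply: IH => j Hj; apply: (@upper_infixx x2 (F j) h x1 [::]); rewrite cats0 -Ex.
  by apply: H; right.
have := U1 _ _ _ _ H1; have := U2 0 _ _ _ H2; rewrite mulSn; lia.
Qed.

(** A zero is either deleted, losing [beta + 1], or paired with a one, losing 1 and using up a
    letter of [y]. *)
Lemma align_rep0_rep1 x y g l : align x y g l -> ones x = 0 -> zeros y = 0 ->
  size x * beta.+1 <= l + beta * size y.
Proof.
elim=> {x y g l} //= [[] x y g l|[] x y g l|[] [] x y g l] _ IH //= Ex Ey;
have {Ex Ey}: size x * beta.+1 <= l + beta * size y by apply: IH; lia.
all: by rewrite ?mulSn ?mulnS; lia.
Qed.

Lemma upper_rep0r x y h V : upper x y h -> upper (x ++ rep0 V) y h.
Proof.
move=> H K K' g l /align_splitx [A [B [g1 [g2 [l1 [l2 [EA HA HB -> ->]]]]]]].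
have := upper_infix H (u := [::]) EA HA.
have := align_gain_x HB; rewrite ones_rep0; lia.
Qed.

(* Makes the lengths equal: the marker [rep1 b] keeps the [r] final zeros from being
   absorbed, at a known cost. *)
Lemma pad_upper x y h K V b r : beta <= 1 -> upper x y h ->
  ones y + 2 * r <= b -> K + 2 * size y + r <= V ->
  forall g l, align ((x ++ rep0 V) ++ rep1 b ++ rep0 r)
    ((rep0 K ++ y ++ rep0 (K + V)) ++ rep1 b) g l ->
  g + r * beta.+1 <= h + b + l.
Proof.
move=> lebeta /(@upper_rep0r _ _ _ V) H leb leV g l.
case/align_splitx=> A [? [gA [? [lA [? [EA HA HBC Eg El]]]]]].
case/align_splitx: HBC => B [C [gB [gC [lB [lC [? HB HC ? ?]]]]]]; subst.
have gA2 := align_gain_y HA; have gB2 := align_gain_y HB.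
have gB1 := align_gain_x HB; have gC1 := align_gain_x HC.
have rC := align_rep0_loss HC.
rewrite !count_repE in gB1 gC1.
have leyy := zerosD_ones y.
have lr : r * beta.+1 <= 2 * r by rewrite mulnC leq_mul2r ltnS lebeta orbT.
rewrite (catA A) in EA.
(* If the last window contains all of [rep1 b], the other two gain at most [ones y], and [leb]
   suffices. *)
case: (cat_eq_cat EA) => [[R [EAB EC]]|[R [E EC]]]; last first.
  move/(congr1 ones): E; rewrite !count_repE; lia.
have [EC0 EC1] : ones R + size C = b /\ zeros C = 0.
  move/(congr1 size): (EC); move/(congr1 zeros): (EC); move: (zerosD_ones R).
  by rewrite size_cat !count_repE size_nseq; lia.
have := align_rep0_rep1 HC; rewrite ones_rep0 size_nseq => /(_ erefl EC1) lC1.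
have lC2 : r * beta.+1 <= lC + r.
  by case: (beta) lebeta => [|[|//]] _; rewrite ?muln1 ?muln2; lia.
have lC3 : r * beta.+1 <= lC + size C.
  by case: (beta) lebeta lC1 => [|[|//]] _; rewrite ?mul0n ?mul1n; lia.
case: (cat_eq_cat EAB) => [[Q [EP EB]]|[Q [EB ER]]]; last first.
  move: HA; rewrite EB => /align_splity [x1 [x2 [g1 [g2 [l1 [l2 [Ex H1 H2 -> ->]]]]]]].
  have U1 : upper x1 y h.
    by apply: (@upper_infixx x1 y h [::] x2); rewrite /= -Ex.
  have := U1 _ _ _ _ H1; have := align_gain_y H2.
  by move: EC0; rewrite ER count_cat; lia.
have EP' : rep0 K ++ y ++ rep0 (K + V) = [::] ++ A ++ Q by [].
have hA := upper_infix H EP' HA.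
rewrite catA in EP; case: (cat_eq_cat EP) => [[Q' [EA' EQ]]|[Q' [EA' _]]].
  move: EC0 gB2; rewrite EB count_cat; move/(congr1 ones): EQ; rewrite !count_repE; lia.
(* Here [A] stops inside [rep0 K ++ y] and has too few zeros for [rep0 V]; [leV] makes that loss
   sufficient. *)
case/align_splitx: HA => A1 [A2 [? [? [? [l2 [EAA _ HA2 _ ->]]]]]].
have := align_rep0_loss HA2.
move: gA2; move/(congr1 zeros): (EA'); move/(congr1 ones): EA'; rewrite EAA !count_repE; lia.
Qed.
End Alignment.

(** * LCS and edit distance as alignment scores *)

Lemma align_subseq x y g l : align 0 x y g l ->
  exists z : seq bool, [/\ subseq z x, subseq z y & size z + l = zeros x + g].
Proof.
elim=> {x y g l} [|a x y g l _ [z [zx zy e]]|c x y g l _ [z [zx zy e]]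
  |a c x y g l _ [z [zx zy e]]].
- by exists [::].
- exists z; split=> //; last by case: a => /=; lia.
  exact: subseq_trans zx (subseq_cons _ _).
- by exists z; split=> //; apply: subseq_trans zy (subseq_cons _ _).
- case: (boolP (a == c)) => [/eqP <-|ne].
    by exists (a :: z); rewrite /= eqxx; split=> //; move: e; case: a => /=; lia.
  exists z; split; try exact: subseq_trans (subseq_cons _ _).
  by case: a c ne => [] [] //=; lia.
Qed.

Lemma subseq_align (z x y : seq bool) : subseq z x -> subseq z y ->
  exists g l, align 0 x y g l /\ size z + l = zeros x + g.
Proof.
have [n] := ubnP (size x + size y); elim: n z x y => // n IH [|b z] x y.
  move=> _ _ _; have : exists g l, align 0 x [::] g l /\ l = zeros x + g.
    elim: x => [|a x [g [l [Hx e]]]]; first by exists 0, 0; split=> //; apply: align_nil.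
    exists g, (l + (0 + ~~ a)); split; first exact: align_del.
    by rewrite /=; lia.
  case=> g [l [Hx e]]; exists g, l; split; last by rewrite /=; lia.
  by rewrite -[y]cats0; apply: (align_widen y [::] Hx).
case: x y => [|a x] [|c y] //= len.
case: eqP => [<-|_] zx; last first.
  move=> zy; have [||g [l [Hx e]]] := IH (b :: z) x (c :: y) _ zx.
  - by rewrite /=; lia.
  - exact: zy.
  by exists g, (l + (0 + ~~ a)); split; [apply: align_del|move: e => /=; lia].
case: eqP => [<-|_] zy; last first.
  have [||g [l [Hx e]]] := IH (b :: z) (b :: x) y _ _ zy.
  - by rewrite /=; lia.
  - by rewrite /= eqxx.
  by exists g, l; split; [apply: align_ins|].
have [|g [l [Hx e]]] := IH z x y _ zx zy; first by lia.
exists (g + (b && b)), (l + (~~ b && b)); split; first exact: align_pair.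
by case: b {Hx} => /=; lia.
Qed.

(** For [beta = 0] the score [zeros x + g - l] is the number of matched pairs. *)
Lemma lcs_geP t (x y : seq bool) : t <= lcs x y <->
  exists g l, align 0 x y g l /\ t + l <= zeros x + g.
Proof.
split=> [let_|[g [l [H le]]]]; last first.
  have [z [zx zy e]] := align_subseq H.
  have lez : size z < (size x).+1 by rewrite ltnS size_subseq.
  apply: (@leq_trans (size z)); first by lia.
  rewrite /lcs (bigD1 (Ordinal lez)) ?leq_maxl //=.
  by apply/existsP; exists (in_tuple z); rewrite /= zx.
have [z [zx zy e]] : exists z : seq bool, [/\ subseq z x, subseq z y & t <= size z].
  move: let_; rewrite /lcs; elim/big_ind: _ => [|m n Hm Hn|k /existsP [z /andP [zx zy]]].
  - by rewrite leqn0 => /eqP ->; exists [::]; rewrite !sub0seq.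
  - by rewrite leq_max => /orP [/Hm|/Hn].
  - by move=> le; exists z; rewrite size_tuple.
by have [g [l [H e']]] := subseq_align zx zy; exists g, l; split=> //; lia.
Qed.

Lemma edits_cons (A : Type) (a : A) k s t : edits k s t -> edits k (a :: s) (a :: t).
Proof.
elim=> {k s t} [s|k s t u st _ IH]; first exact: edits0.
apply: editsS IH; case: st => [s1 b s2|s1 b s2|s1 b c s2]; rewrite -!cat_cons.
- exact: edit_ins.
- exact: edit_del.
- exact: edit_sub.
Qed.

(** For [beta = 1] the score is [size x + size y] minus the number of insertions, deletions and
    substitutions; the equation follows after cancelling [size x]. *)
Lemma align_edits x y g l : align 1 x y g l ->
  exists2 k, edits k x y & k + zeros x + g = size y + l.
Proof.
elim=> {x y g l} [|a x y g l _ [k ed e]|c x y g l _ [k ed e]|a c x y g l _ [k ed e]].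
- by exists 0 => //; apply: edits0.
- exists k.+1; last by case: a => /=; lia.
  by apply: editsS ed; apply: (@edit_del _ [::]).
- exists k.+1; last by rewrite /=; lia.
  by apply: editsS (edits_cons c ed); apply: (@edit_ins _ [::]).
case: (boolP (a == c)) => [/eqP <-|ne].
  by exists k; [apply: edits_cons|case: a => /=; lia].
exists k.+1; last by case: a c ne => [] [] //=; lia.
by apply: editsS (edits_cons c ed); apply: (@edit_sub _ [::]).
Qed.

Lemma align_subst a b y g l : align 1 [:: b] y g l ->
  exists g' l', align 1 [:: a] y g' l' /\ ~~ b + g + l' <= 1 + ~~ a + g' + l.
Proof.
move Ex: [:: b] => x H; elim: H Ex => {x y g l} [|b' x y g l H _|c x y g l _ IH
  |b' c x y g l H _] //.
- case=> -> Ex; exists g, (l + (1 + ~~ a)); rewrite -Ex in H *; split; first exact: align_del.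
  by case: a b' => [] []; lia.
- by move=> /IH [g' [l' [H le]]]; exists g', l'; split=> //; apply: align_ins.
- case=> -> Ex; exists (g + (a && c)), (l + (~~ a && c)); rewrite -Ex in H *.
  split; first exact: align_pair.
  by case: a b' c => [] [] []; lia.
Qed.

(** Undoes the edits one at a time on the first string: an alignment of the edited string with the
    target becomes one of the original string, and each kind of step costs at most one. *)
Lemma edits_align k x y : edits k x y ->
  exists g l, align 1 x y g l /\ size y + l <= k + zeros x + g.
Proof.
elim=> {k x y} [s|k s t u st _ [g [l [H le]]]].
  exists (ones s), 0; split; last by have := zerosD_ones s; lia.
  elim: s => [|a s IH]; first exact: align_nil.
  by apply: (align_eq (align_pair a a IH)); case: a => /=; lia.
case: st H le => [s1 a s2|s1 a s2|s1 a b s2]; rewrite -?(cat1s _ s2).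
- case/align_splitx=> u1 [? [g1 [? [l1 [? [-> H1 H ? ?]]]]]].
  case/align_splitx: H => u2 [u3 [g2 [g3 [l2 [l3 [? H2 H3 ? ?]]]]]]; subst => le.
  exists (g1 + (0 + g3)), (l1 + (0 + l3)); split.
    by apply/(align_cat H1)/(align_cat (align_skip _ _)).
  have /= := align_gain_x H2; have := align_loss H2.
  move: le; rewrite !size_cat !count_cat /=; case: a {H2} => /=; lia.
- case/align_splitx=> u1 [u2 [g1 [g2 [l1 [l2 [-> H1 H2 -> ->]]]]]] le.
  exists (g1 + g2), (l1 + (l2 + (1 + ~~ a))); split.
    by apply/(align_cat H1)/align_del.
  by move: le; rewrite !count_cat /=; case: a; lia.
- case/align_splitx=> u1 [? [g1 [? [l1 [? [-> H1 H ? ?]]]]]].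
  case/align_splitx: H => u2 [u3 [g2 [g3 [l2 [l3 [? H2 H3 ? ?]]]]]]; subst => le.
  have [g' [l' [H2' le']]] := align_subst a H2.
  exists (g1 + (g' + g3)), (l1 + (l' + l3)); split.
    by apply/(align_cat H1)/(align_cat H2').
  by move: le; rewrite !size_cat !count_cat /=; lia.
Qed.

Lemma edit_distance_leP t x y : edit_distance x y <= t <->
  exists g l, align 1 x y g l /\ size y + l <= t + zeros x + g.
Proof.
rewrite /edit_distance; case: ex_minnP => m /asboolP Hm min; split=> [le|].
  by have [g [l [H le']]] := edits_align Hm; exists g, l; split=> //; lia.
case=> g [l [/align_edits [k /asboolP /min lem e] le]]; lia.
Qed.

(** * Gadgets *)

Definition lft (t : tree) := if t is Node a _ then a else Leaf.
Definition rgt (t : tree) := if t is Node _ b then b else Leaf.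
Definition is_node (t : tree) := if t is Node _ _ then true else false.

Fixpoint nth_tree (l : tree) i := if i is i'.+1 then nth_tree (rgt l) i' else lft l.

(* An item is [Node status M], with [M] the adjacency matrix.  A resolved status
   [Node _ tag] has [tag] equal to [Leaf] when the other side owns the layer (all
   edges are allowed), to [Node Leaf b] when the variable has value [b], and to
   [Node (Node _ _) _] for the padding layers, which have all the edges leaving
   node 0 and no other. *)
Definition leafbit (it : tree) (u v : nat) : bool :=
  match rgt (lft it) with
  | Leaf => true
  | Node Leaf b =>
      let e := nth_tree (nth_tree (rgt it) u) v in
      is_node (if is_node b then rgt e else lft e)
  | Node (Node _ _) _ => u == 0
  end.

(* [leafx a] and [leafy b] have two ones; both can be matched without losing the zeros
   in between iff [a && b]. *)
Definition leafx (b : bool) := if b then [:: true; false; true; false]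
  else [:: true; false; false; true].
Definition leafy (b : bool) := if b then [:: true; false; true; false]
  else [:: true; true; false; false].

(** Matching both ones would squeeze [s] zeros into a run of [t], at a loss of at least one. *)
Lemma upper_gap beta s t z y : t < s -> ones z = 0 -> ones y = 0 ->
  upper beta (true :: rep0 s ++ true :: z) (true :: rep0 t ++ true :: y) 1.
Proof.
move=> lts oz oy K K' g l; rewrite -cat1s.
case/align_splitx=> A [? [gA [? [lA [? [EA HA HBC Eg El]]]]]].
case/align_splitx: HBC => B [C [gB [gC [lB [lC [? HB HC ? ?]]]]]]; subst.
have gA1 := align_gain_x HA; have gA2 := align_gain_y HA.
have gB1 := align_gain_x HB; have gC1 := align_gain_x HC.
have gC2 := align_gain_y HC.
have LB := align_rep0_loss HB; rewrite /= !count_repE oz in gB1 gA1 gC1.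
case: (cat_eq_cat EA) => [[A' [EA' E1]]|[r [/(congr1 ones) E _]]]; last first.
  by move: E; rewrite !count_repE; lia.
case: A' EA' E1 => [|a A'] EA'; first by move: gA2; rewrite EA' !count_repE /=; lia.
case=> _; rewrite -!catA (catA A') => E1.
have ZZ (s1 s2 : seq bool) : s1 = s2 -> zeros s1 = zeros s2 by move=> ->.
case: (cat_eq_cat E1) => [[r [/ZZ E2 E3]]|[r [/ZZ E2 _]]]; last first.
  by move: E2; rewrite !count_repE; lia.
case: r E2 E3 => [|b r] E2 E3; first by move: E2; rewrite !count_repE /=; lia.
case: E3 => _ /(congr1 ones); rewrite !count_repE; lia.
Qed.

Lemma upper_leaf beta a b : upper beta (leafx a) (leafy b) (1 + (a && b)).
Proof.
case: a b => [] [].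
- exact: (@upper_ones beta (leafx true) (leafy true)).
- exact: (@upper_gap beta 1 0 [:: false] [:: false; false]).
- exact: (@upper_gap beta 2 1 [::] [:: false]).
- exact: (@upper_gap beta 2 0 [::] [:: false; false]).
Qed.

Lemma align_self beta x : align beta x x (ones x) 0.
Proof.
elim: x => [|a s IH]; first exact: align_nil.
by apply: (align_eq (align_pair a a IH)); case: a => /=; lia.
Qed.

Lemma zeros_le s : zeros s <= size s. Proof. exact: count_size. Qed.
Lemma ones_le s : ones s <= size s. Proof. exact: count_size. Qed.

Lemma rev_iota_split W w : w < W -> exists l1 l2,
  [/\ rev (iota 0 W) = l1 ++ w :: l2, size l1 = W.-1 - w & size l2 = w].
Proof.
move=> ltw; exists (rev (iota w.+1 (W.-1 - w))), (rev (iota 0 w)).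
rewrite !size_rev !size_iota; split=> //.
have -> : W = w + (1 + (W.-1 - w)) by lia.
rewrite !iotaD !rev_cat /= add0n addn1 -catA /=.
by congr (rev (iota _ _) ++ _); lia.
Qed.

Lemma In_mem (T : eqType) (x : T) s : List.In x s <-> x \in s.
Proof.
elim: s => //= y s IH; rewrite inE; split=> [[->|/IH ->]|/orP [/eqP ->|/IH]];
  by rewrite ?eqxx ?orbT //; auto.
Qed.

(** * Savitch gadgets for one pair of half assignments *)

Section Gadget.
Variables beta W : nat.

(* [base d] bounds the lengths of the gadgets of depth [d], and [scale d] is the
   length of the runs of ones and zeros in the gadgets of depth [d.+1]. *)
Definition growth := (2 * W + 2) * ((4 * W + 1) * (2 * W + 5)).
Definition base d := (W + 4) * growth ^ d.
Definition scale d := (2 * W + 2) * base d.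

(** In units of [scale d], the core of the second string has length at most [2 * W + 5], and the
    zero runs on its two sides have [2 * W] times that length each. *)
Lemma baseS d : base d.+1 = (4 * W + 1) * ((2 * W + 5) * scale d).
Proof. by rewrite /scale /base expnS /growth; nia. Qed.

(** In the second string [W.-1 - w] blocks precede that of node [w] and [w] follow it, each with two
    runs of [k] zeros; the zero runs here reproduce these offsets. *)
Definition groupx k w x1 x2 :=
  rep1 k ++ rep0 ((2 * (W.-1 - w) + 1) * k) ++ x1 ++ rep0 k ++ x2 ++
  rep0 ((2 * w + 1) * k) ++ rep1 k.

(** Middle nodes are listed downwards, the order in which a recursion on a unary counter visits
    them. The separators are at least as long as the opposite core, as [upper_flatten] requires. *)
Fixpoint gadgetX d t u v := if d is d'.+1 then
    let k := scale d' in
    flatten [seq groupx k w (gadgetX d' (lft t) u w) (gadgetX d' (rgt t) w v) ++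
                 rep0 ((2 * W + 5) * k) | w <- rev (iota 0 W)]
  else leafx (leafbit t u v).

Definition blocky k y1 y2 := rep0 k ++ y1 ++ rep0 k ++ y2.

Fixpoint gadgetY d t u v := if d is d'.+1 then
    let k := scale d' in
    let K := 2 * W * ((2 * W + 5) * k) in
    rep0 K ++ (rep1 k ++
      flatten [seq blocky k (gadgetY d' (lft t) u w) (gadgetY d' (rgt t) w v) | w <- rev (iota 0 W)]
      ++ rep0 k ++ rep1 k) ++ rep0 K
  else leafy (leafbit t u v).

(** The length is independent of the half assignment and of the end nodes, so the length of an
    instance is a function of [n], [T] and [W]. *)
Fixpoint len_gadgetY d := if d is d'.+1 then
    let k := scale d' in
    2 * (2 * W * ((2 * W + 5) * k)) + 3 * k + W * (2 * k + 2 * len_gadgetY d')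
  else 4.

(* One less than the gain of a satisfied gadget. *)
Fixpoint gain d := if d is d'.+1 then 2 * scale d' + 2 * gain d' + 1 else 1.

Fixpoint reach d tx ty u v := if d is d'.+1 then
    has (fun w => reach d' (lft tx) (lft ty) u w && reach d' (rgt tx) (rgt ty) w v)
        (iota 0 W)
  else leafbit tx u v && leafbit ty u v.

Lemma size_flatten_const (I : Type) (F : I -> seq bool) c (s : seq I) :
  (forall i, size (F i) = c) -> size (flatten [seq F i | i <- s]) = size s * c.
Proof.
by move=> H; elim: s => //= i s IH; rewrite size_cat H IH mulSn.
Qed.

Lemma size_flatten_le (I : eqType) (F : I -> seq bool) c (s : seq I) :
  {in s, forall i, size (F i) <= c} -> size (flatten [seq F i | i <- s]) <= size s * c.
Proof.
elim: s => //= i s IH H; rewrite size_cat mulSn leq_add ?H ?mem_head //.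
by apply: IH => j js; apply: H; rewrite inE js orbT.
Qed.

Lemma size_gadgetY d t u v : size (gadgetY d t u v) = len_gadgetY d.
Proof.
elim: d t u v => [|d IH] t u v /=; first by case: (leafbit _ _ _).
rewrite !size_cat !size_nseq.
rewrite (@size_flatten_const _ _ (2 * scale d + 2 * len_gadgetY d)).
  by rewrite size_rev size_iota; lia.
by move=> w; rewrite /blocky !size_cat !size_nseq !IH; lia.
Qed.

Lemma len_gadgetY_base d : len_gadgetY d <= base d.
Proof.
elim: d => [|d IH] /=; first by rewrite /base expn0; lia.
rewrite baseS; set k := scale d.
have : W * (2 * len_gadgetY d) <= k by rewrite /k /scale; nia.
lia.
Qed.

Lemma base_gt0 d : 0 < base d.
Proof. by rewrite /base muln_gt0 expn_gt0 /growth; lia. Qed.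

Lemma base_scale d : 2 * base d <= scale d.
Proof. by rewrite /scale leq_mul2r; lia. Qed.

Lemma gain_base d : gain d <= base d.
Proof.
elim: d => [|d IH] /=; first by rewrite /base expn0; lia.
rewrite baseS; have := base_scale d; have := base_gt0 d; nia.
Qed.

Lemma size_gadgetXS_base d t u v : (forall t u v, size (gadgetX d t u v) <= base d) ->
  size (gadgetX d.+1 t u v) <= W * ((4 * W + 9) * scale d).
Proof.
move=> IH; set k := scale d.
have le : {in rev (iota 0 W), forall w,
    size (groupx k w (gadgetX d (lft t) u w) (gadgetX d (rgt t) w v) ++
          rep0 ((2 * W + 5) * k)) <= (4 * W + 9) * k}.
  move=> w; rewrite mem_rev mem_iota => /andP [_ ltw].
  have := base_scale d; have := IH (lft t) u w; have := IH (rgt t) w v.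
  rewrite !size_cat !size_nseq -/k => H2 H1 Hk.
  suff : (2 * (W.-1 - w) + 1) * k + (2 * w + 1) * k = 2 * W * k by lia.
  by rewrite -mulnDl; congr (_ * _); lia.
rewrite /= -/k; apply: leq_trans (size_flatten_le le) _.
by rewrite size_rev size_iota.
Qed.

Lemma size_gadgetX d t u v : size (gadgetX d t u v) <= base d.
Proof.
elim: d t u v => [|d IH] t u v.
  by rewrite /= /base expn0; case: (leafbit _ _ _) => /=; lia.
by apply: leq_trans (size_gadgetXS_base _ _ _ IH) _; rewrite baseS; nia.
Qed.

Lemma size_gadgetXS d t u v : size (gadgetX d.+1 t u v) <= W * ((4 * W + 9) * scale d).
Proof. exact/size_gadgetXS_base/size_gadgetX. Qed.

Definition corey d t u v := let k := scale d in
  rep1 k ++ flatten [seq blocky k (gadgetY d (lft t) u w) (gadgetY d (rgt t) w v) | w <- rev (iota 0 W)]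
  ++ rep0 k ++ rep1 k.

Lemma blocks_zeros k c (F G : nat -> seq bool) l :
  (forall w, size (F w) <= c) -> (forall w, size (G w) <= c) ->
  let n := zeros (flatten [seq blocky k (F w) (G w) | w <- l]) in
  2 * size l * k <= n <= size l * (2 * k + 2 * c).
Proof.
move=> HF HG; elim: l => //= w l IH.
have := zeros_le (F w); have := zeros_le (G w); have := HF w; have := HG w.
rewrite !count_repE; lia.
Qed.

Lemma blocks_head k (F G : nat -> seq bool) l : exists R,
  flatten [seq blocky k (F w) (G w) | w <- l] ++ rep0 k = rep0 k ++ R.
Proof.
case: l => [|w l]; first by exists [::]; rewrite cats0.
by eexists; rewrite /= /blocky -!catA.
Qed.

(** The inequalities with [3 * base d] say that [L] and [R] alone are too short for the zero runs of
    [groupx], as the upper bound needs. The other two say that one adjacent run of zeros makes them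
    long enough for a lossless alignment. *)
Lemma corey_split d t u v w : w < W -> exists L R,
  [/\ corey d t u v = rep1 (scale d) ++ L ++ rep0 (scale d) ++ gadgetY d (lft t) u w ++
        rep0 (scale d) ++ gadgetY d (rgt t) w v ++ rep0 (scale d) ++ R ++ rep1 (scale d),
      zeros L + 3 * base d <= (2 * (W.-1 - w) + 1) * scale d,
      (2 * (W.-1 - w) + 1) * scale d <= zeros L + scale d,
      zeros R + 3 * base d <= (2 * w + 1) * scale d &
      (2 * w + 1) * scale d <= scale d + zeros R].
Proof.
move=> ltw; have [l1 [l2 [E s1 s2]]] := rev_iota_split ltw.
have HF w' : size (gadgetY d (lft t) u w') <= base d by rewrite size_gadgetY len_gadgetY_base.
have HG w' : size (gadgetY d (rgt t) w' v) <= base d by rewrite size_gadgetY len_gadgetY_base.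
have := blocks_zeros (scale d) l1 HF HG; have := blocks_zeros (scale d) l2 HF HG.
have [R HR] := blocks_head (scale d) (fun w => gadgetY d (lft t) u w) (fun w => gadgetY d (rgt t) w v) l2.
have := congr1 zeros HR; rewrite !count_repE s1 s2 => ZR /andP [R1 R2] /andP [L1 L2].
exists (flatten [seq blocky (scale d) (gadgetY d (lft t) u w) (gadgetY d (rgt t) w v) | w <- l1]), R.
split; last 1 first.
- by lia.
- rewrite /corey E map_cat flatten_cat /= /blocky -!catA.
  by congr (_ ++ (_ ++ (_ ++ (_ ++ (_ ++ (_ ++ _)))))); rewrite catA HR -!catA.
- have : (2 * (W.-1 - w) + 3) * base d <= scale d by rewrite leq_mul2r; lia.
  by move: L2; move: (W.-1 - w) (base d) (scale d) => c b k; lia.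
- by lia.
- have : (2 * w + 3) * base d <= scale d by rewrite leq_mul2r; lia.
  by move: R2 ZR; move: (base d) (scale d) => b k; lia.
Qed.

Lemma size_corey d t u v : size (corey d t u v) <= (2 * W + 5) * scale d.
Proof.
rewrite /corey !size_cat !size_nseq.
rewrite (@size_flatten_const _ _ (2 * scale d + 2 * len_gadgetY d)); last first.
  by move=> w; rewrite /blocky !size_cat !size_nseq !size_gadgetY; lia.
rewrite size_rev size_iota; have := len_gadgetY_base d; rewrite /scale; nia.
Qed.

(** A single satisfied subgadget adds one and only reaches [gain d.+1]; two satisfied ones exceed it
    by one, which gives the AND. The OR is [upper_flatten], since only one group can profit. *)
Lemma upper_gadget d tx ty u v :
  upper beta (gadgetX d tx u v) (gadgetY d ty u v) (gain d + reach d tx ty u v).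
Proof.
elim: d tx ty u v => [|d IH] tx ty u v; first exact: upper_leaf.
apply: upper_pad; rewrite -/(corey d ty u v).
apply: upper_flatten; first exact: size_corey.
move=> w /In_mem; rewrite mem_rev mem_iota => /andP [_ ltw].
have [L [R [-> L1 L2 R1 R2]]] := @corey_split d ty u v w ltw.
set r1 := reach d (lft tx) (lft ty) u w; set r2 := reach d (rgt tx) (rgt ty) w v.
have le : r1 && r2 <= reach d.+1 tx ty u v.
  case E : (r1 && r2) => //=; rewrite lt0b; apply/hasP; exists w => //.
  by rewrite mem_iota /= add0n.
have o1 := ones_le (gadgetX d (lft tx) u w); have o2 := ones_le (gadgetX d (rgt tx) w v).
have x1 := size_gadgetX d (lft tx) u w; have x2 := size_gadgetX d (rgt tx) w v.
have z1 := zeros_le (gadgetY d (lft ty) u w); have z2 := zeros_le (gadgetY d (rgt ty) w v).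
rewrite size_gadgetY in z1; rewrite size_gadgetY in z2.
have y := len_gadgetY_base d; have sc := base_scale d.
apply: upper_le.
  by apply: (upper_group (IH (lft tx) (lft ty) u w) (IH (rgt tx) (rgt ty) w v)); lia.
rewrite /= -/r1 -/r2; move: le; rewrite /=; case: r1 r2 => [] [] /=; lia.
Qed.

(** The group of a good middle node is aligned with the core; the other groups vanish in the zero
    runs around it. *)
Lemma align_gadget d tx ty u v : reach d tx ty u v ->
  align beta (gadgetX d tx u v) (gadgetY d ty u v) (gain d).+1 0.
Proof.
elim: d tx ty u v => [|d IH] tx ty u v.
  by rewrite /= => /andP [-> ->]; apply: (align_self beta (leafx true)).
case/hasP => w; rewrite mem_iota => /andP [_ ltw] /andP [/IH A1 /IH A2].
have sx := size_gadgetXS d tx u v.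
have [L [R [E L1 L2 R1 R2]]] := @corey_split d ty u v w ltw.
have [l1 [l2 [El s1 s2]]] := rev_iota_split ltw.
move: sx; rewrite /= -/(corey d ty u v) El map_cat flatten_cat /= !size_cat => sx.
rewrite -(catA (groupx _ _ _ _)).
have leK (a k : nat) : a <= W * ((4 * W + 9) * k) -> a <= 2 * W * ((2 * W + 5) * k).
  move=> le; apply: leq_trans le _.
  have -> : 2 * W * ((2 * W + 5) * k) = W * ((4 * W + 10) * k) by lia.
  by rewrite leq_mul2l leq_mul2r; apply/orP; right; lia.
apply: (align_eq (align_cat (align_absorb beta _) (align_cat (_ : align _ _ _ (gain d.+1).+1 0)
   (align_absorb beta _)))) => //=; first by apply: leK; lia.
- rewrite E /groupx.
  have := align_rep0_le beta (p := (2 * (W.-1 - w) + 1) * scale d) (y := L ++ rep0 (scale d)).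
  rewrite !count_repE => /(_ L2) HL.
  have := align_rep0_le beta (p := (2 * w + 1) * scale d) (y := rep0 (scale d) ++ R).
  rewrite !count_repE => /(_ R2) HR.
  have H1 := align_rep1 beta (scale d); have H0 := align_self beta (rep0 (scale d)).
  have := align_cat H1 (align_cat HL (align_cat A1 (align_cat H0 (align_cat A2 (align_cat HR H1))))).
  rewrite -!catA => H; apply: (align_eq H) => //; rewrite /= ones_rep0; lia.
- by apply: leK; rewrite size_cat; lia.
- by rewrite addn0.
Qed.
End Gadget.

(** * Combining all pairs of half assignments into one instance *)

Section Outer.
Variables W D : nat.
Let S := scale W D.

Definition null_gain := scale W D + gain W D.

(** The marker [rep1 S] fits into the longer marker of [coreY], so a satisfied pair gains
    [S + gain W D + 1], one more than the null slot. *)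
Definition coreX t := rep1 S ++ rep0 S ++ gadgetX W D t 0 0.
Definition coreY t := rep1 null_gain ++ rep0 S ++ gadgetY W D t 0 0.
Definition blockX t := (rep1 null_gain ++ rep0 (4 * S)) ++ coreX t ++ rep0 (4 * S).
Definition blockY t := rep0 (16 * S) ++ coreY t ++ rep0 (16 * S).

Definition listX ts := flatten [seq blockX t | t <- ts].
Definition listY us := flatten [seq blockY u | u <- us].

(* Three copies of the list, so that any entry has enough entries on both sides. *)
Definition unpaddedX m ts :=
  (listX (ts ++ ts ++ ts) ++ rep0 (512 * (S * m))) ++ rep1 (512 * (S * m)).
Definition instanceY m us :=
  (rep0 (64 * (S * m)) ++ listY us ++ rep0 (64 * (S * m) + 512 * (S * m)))
  ++ rep1 (512 * (S * m)).
Definition padding m ts us := size (instanceY m us) - size (unpaddedX m ts).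
Definition instanceX m ts us := unpaddedX m ts ++ rep0 (padding m ts us).

Lemma gain_le_scale : 2 * gain W D <= S.
Proof. have := gain_base W D; have := base_scale W D; rewrite -/S; lia. Qed.

Lemma len_le_scale : 2 * len_gadgetY W D <= S.
Proof. have := len_gadgetY_base W D; have := base_scale W D; rewrite -/S; lia. Qed.

Lemma size_gadgetX_scale t : 2 * size (gadgetX W D t 0 0) <= S.
Proof. have := size_gadgetX W D t 0 0; have := base_scale W D; rewrite -/S; lia. Qed.

Lemma size_coreY u : size (coreY u) = null_gain + S + len_gadgetY W D.
Proof. by rewrite !size_cat !size_nseq size_gadgetY; lia. Qed.

Lemma size_blockX t : size (blockX t) <= 16 * S.
Proof.
rewrite !size_cat !size_nseq /null_gain -/S; have := gain_le_scale; have := size_gadgetX_scale t; lia.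
Qed.

Lemma size_blockY u : size (blockY u) = 33 * S + null_gain + len_gadgetY W D.
Proof. rewrite !size_cat !size_nseq size_gadgetY; lia. Qed.

Lemma size_listX ts : size (listX ts) <= size ts * (16 * S).
Proof.
by elim: ts => //= t ts IH; rewrite /listX /= size_cat mulSn leq_add ?size_blockX.
Qed.

Lemma size_listY us : size (listY us) = size us * (33 * S + null_gain + len_gadgetY W D).
Proof. exact/size_flatten_const/size_blockY. Qed.

Lemma listX_cat ts ts' : listX (ts ++ ts') = listX ts ++ listX ts'.
Proof. by rewrite /listX map_cat flatten_cat. Qed.

Lemma listY_cat ts ts' : listY (ts ++ ts') = listY ts ++ listY ts'.
Proof. by rewrite /listY map_cat flatten_cat. Qed.

Variable beta : nat.

Lemma upper_listX ts u : (forall t, List.In t ts -> ~~ reach W D t u 0 0) ->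
  upper beta (listX ts) (coreY u) null_gain.
Proof.
(* [None] stands for a null slot: null slots and cores become one list whose separators are at least
   as long as [coreY u]. *)
pose F (o : option tree) := if o is Some t then coreX t else rep1 null_gain.
move=> H; have -> : listX ts = flatten [seq F o ++ rep0 (4 * S) |
    o <- flatten [seq [:: None; Some t] | t <- ts]].
  by rewrite /listX; elim: (ts) => //= t l ->; rewrite /blockX -!catA.
apply: upper_flatten => [|[t|] /=].
- by rewrite size_coreY /null_gain -/S; have := gain_le_scale; have := len_le_scale; lia.
- move=> Ht; have {Ht} /H nr : List.In t ts.
    by elim: (ts) Ht => //= t' l IH [//|[[->]|/IH]]; auto.
  have leS : ones (gadgetX W D t 0 0) <= S.
    by have := size_gadgetX_scale t; have := ones_le (gadgetX W D t 0 0); lia.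
  have := @upper_null beta _ _ _ S null_gain S (@upper_gadget beta W D t u 0 0) leS leS.
  by rewrite (negbTE nr) addn0.
- by move=> _; apply: upper_le (@upper_ones _ _ _) _; rewrite ones_rep1.
Qed.

Lemma align_null t u : align beta (blockX t) (blockY u) null_gain 0.
Proof.
have sz : size (rep0 (4 * S) ++ coreX t ++ rep0 (4 * S)) <= 16 * S.
  by rewrite !size_cat !size_nseq; have := size_gadgetX_scale t; lia.
have := align_cat (align_rep1 beta null_gain) (align_absorb beta sz).
rewrite -[rep0 (16 * S)]cat0s addn0 -catA => H.
have {H} := align_cat (align_rep1 beta null_gain)
  (align_widen (rep0 S ++ gadgetY W D u 0 0) [::] (align_absorb beta sz)).
move/(align_widen (rep0 (16 * S)) [::]); rewrite addn0 !cats0.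
by rewrite /blockX /blockY /coreY -!catA.
Qed.

Lemma align_reach t u : reach W D t u 0 0 ->
  align beta (blockX t) (blockY u) null_gain.+1 0.
Proof.
move=> r; have sz : size (rep1 null_gain ++ rep0 (4 * S)) <= 16 * S.
  by rewrite !size_cat !size_nseq /null_gain -/S; have := gain_le_scale; lia.
have sz' : size (rep0 (4 * S)) <= 16 * S by rewrite size_nseq; lia.
apply: (align_eq (align_cat (align_absorb beta sz) (align_cat (_ : align _ _ _ null_gain.+1 0)
  (align_absorb beta sz')))); rewrite ?addn0 //.
have := align_cat (align_widen [::] (rep1 (gain W D)) (align_rep1 beta S))
  (align_cat (align_self beta (rep0 S)) (align_gadget beta r)).
rewrite /coreY /null_gain nseqD !cat0s ones_rep0 -/S => H.
by apply: (align_eq H); lia.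
Qed.

Lemma align_lists ts us : size ts = size us ->
  align beta (listX ts) (listY us) (size us * null_gain) 0.
Proof.
elim: ts us => [|t ts IH] [|u us] //=; first by move=> _; apply: align_nil.
case=> /IH H.
by rewrite /listX /listY /= mulSn -[0]addn0; apply: align_cat H; apply: align_null.
Qed.

Lemma align_outer m ts us t u : size ts = m -> size us <= m ->
  List.In t ts -> List.In u us -> reach W D t u 0 0 ->
  align beta (listX (ts ++ ts ++ ts)) (rep0 (64 * (S * m)) ++ listY us ++ rep0 (64 * (S * m)))
    (size us * null_gain + 1) 0.
Proof.
move=> sts sus tt uu r.
have [t1 [t2 Et]] : exists t1 t2, ts = t1 ++ t :: t2 := List.in_split _ _ tt.
have [u1 [u2 Eu]] : exists u1 u2, us = u1 ++ u :: u2 := List.in_split _ _ uu.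
have sE : size u1 + (size u2).+1 = size us by rewrite Eu size_cat.
have E3 : ts ++ ts ++ ts = (ts ++ t1) ++ t :: (t2 ++ ts).
  by rewrite {2}Et -!catA.
(* Dropping [i] entries leaves as many before [t] as precede [u], so the two face each other. *)
pose i := size (ts ++ t1) - size u1.
have -> : ts ++ ts ++ ts = take i (ts ++ t1) ++ drop i (ts ++ t1) ++
    [:: t] ++ take (size u2) (t2 ++ ts) ++ drop (size u2) (t2 ++ ts).
  by rewrite E3 cat_take_drop catA cat_take_drop.
have absorb l : size l <= 3 * m -> align beta (listX l) (rep0 (64 * (S * m))) 0 0.
  move=> le; apply: align_absorb; apply: leq_trans (size_listX _) _.
  have : size l * (16 * S) <= 3 * m * (16 * S) by rewrite leq_mul2r le orbT.
  lia.
have s3 : size (ts ++ t1) + (size (t2 ++ ts)).+1 = 3 * m.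
  by rewrite -[_.+1]/(size (t :: t2 ++ ts)) -size_cat -E3 !size_cat; lia.
have sd : size (drop i (ts ++ t1)) = size u1.
  by rewrite size_drop size_cat /i; have := size_cat ts t1; lia.
have st : size (take (size u2) (t2 ++ ts)) = size u2.
  by rewrite size_take size_cat; case: ifP; lia.
have A1 : align beta (listX (take i (ts ++ t1))) (rep0 (64 * (S * m))) 0 0.
  by apply: absorb; rewrite size_take; case: ifP; lia.
have A5 : align beta (listX (drop (size u2) (t2 ++ ts))) (rep0 (64 * (S * m))) 0 0.
  by apply: absorb; rewrite size_drop; lia.
have H := align_cat A1 (align_cat (align_lists sd) (align_cat (align_reach r)
   (align_cat (align_lists st) A5))).
rewrite Eu (listY_cat u1) -[u :: u2]cat1s listY_cat !listX_cat.
have lX : listX [:: t] = blockX t by rewrite /listX /= cats0.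
have lY : listY [:: u] = blockY u by rewrite /listY /= cats0.
rewrite lX lY {lX lY}; move: (blockX t) (blockY u) H => bX bY H; rewrite -!catA.
by apply: (align_eq H) => //; rewrite size_cat /=; lia.
Qed.

Lemma size_unpaddedX m ts : size ts = m ->
  size (unpaddedX m ts) <= (48 + 1024) * (S * m).
Proof.
move=> sts; rewrite !size_cat !size_nseq; have := size_listX (ts ++ ts ++ ts).
by rewrite !size_cat sts; lia.
Qed.

Lemma size_instanceY m us : size (instanceY m us) =
  1152 * (S * m) + size us * (33 * S + null_gain + len_gadgetY W D).
Proof. by rewrite !size_cat !size_nseq size_listY; lia. Qed.

(** An accepting pair lifts the gain above [size us * null_gain]. The end marker contributes
    [512 * (S * m)] and the final zeros cost [beta + 1] each, whether or not such a pair exists. *)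
Lemma instance_correct m ts us : beta <= 1 -> size ts = m -> size us <= m ->
  (exists t u, [/\ List.In t ts, List.In u us & reach W D t u 0 0]) <->
  (exists g l, align beta (instanceX m ts us) (instanceY m us) g l /\
    size us * null_gain + 1 + 512 * (S * m) + l <= g + padding m ts us * beta.+1).
Proof.
move=> lebeta sts sus; split=> [[t [u [tt uu r]]]|[g [l [H le]]]].
  have A1 := align_outer sts sus tt uu r.
  have A2 := align_self beta (rep0 (512 * (S * m))).
  have A3 := align_rep1 beta (512 * (S * m)).
  have H := align_cat (align_cat (align_cat A1 A2) A3)
    (align_del_rep0 beta (padding m ts us)).
  exists (size us * null_gain + 1 + 512 * (S * m)), (padding m ts us * beta.+1).
  split=> //.
  have -> : instanceY m us = (((rep0 (64 * (S * m)) ++ listY us ++ rep0 (64 * (S * m)))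
      ++ rep0 (512 * (S * m))) ++ rep1 (512 * (S * m))) ++ [::].
    by rewrite /instanceY nseqD -!catA cats0.
  by apply: (align_eq H); rewrite ?ones_rep0; lia.
apply: contrapT => nr.
have U : upper beta (listX (ts ++ ts ++ ts)) (listY us) (size us * null_gain).
  apply: upper_blocks => u uu; apply: upper_listX => t tt; apply/negP => r.
  apply: nr; exists t, u; split=> //.
  by case/List.in_app_iff: tt => // /List.in_app_iff [].
have sY := size_instanceY m us; have sX := size_unpaddedX sts.
have sl := size_listY us; have ol := ones_le (listY us).
have sk : size us * (33 * S + null_gain + len_gadgetY W D) <= m * (36 * S).
  rewrite leq_mul // /null_gain -/S; have := gain_le_scale; have := len_le_scale; lia.
have r : padding m ts us <= 164 * (S * m).
  rewrite /padding sY !size_cat !size_nseq; lia.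
(* In units of [S * m]: 36 + 2 * 164 here, and 64 + 2 * 36 + 164 for [cV], both below 512. *)
have cb : ones (listY us) + 2 * padding m ts us <= 512 * (S * m) by lia.
have cV : 64 * (S * m) + 2 * size (listY us) + padding m ts us <= 512 * (S * m) by lia.
have := pad_upper lebeta U cb cV (g := g) (l := l).
rewrite catA => /(_ H); lia.
Qed.
End Outer.

(** * Branching programs and half assignments *)

Fixpoint leaves d t := if d is d'.+1 then leaves d' (lft t) ++ leaves d' (rgt t) else [:: t].

Fixpoint map_tree f d t :=
  if d is d'.+1 then Node (map_tree f d' (lft t)) (map_tree f d' (rgt t)) else f t.

Lemma leaves_map f d t : leaves d (map_tree f d t) = map f (leaves d t).
Proof. by elim: d t => //= d IH t; rewrite !IH map_cat. Qed.

Lemma size_leaves d t : size (leaves d t) = 2 ^ d.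
Proof. by elim: d t => //= d IH t; rewrite size_cat !IH expnS; lia. Qed.

(** * Walks through the layers and their evaluation by halving *)

Section Paths.
Variable W : nat.

Fixpoint walk (es : seq (nat -> nat -> bool)) (u v : nat) :=
  if es is e :: es' then has (fun w => e u w && walk es' w v) (iota 0 W) else u == v.

Lemma walk_cons e es u v :
  walk (e :: es) u v = has (fun w => e u w && walk es w v) (iota 0 W).
Proof. by []. Qed.

Lemma walk_cat es1 es2 u v : u < W -> v < W ->
  walk (es1 ++ es2) u v = has (fun w => walk es1 u w && walk es2 w v) (iota 0 W).
Proof.
elim: es1 u => [|e es IH] u ltu ltv /=.
  apply/idP/hasP => [H|[w _ /andP [/eqP <-]]] //.
  by exists u; [rewrite mem_iota|rewrite eqxx].
have I w : (w \in iota 0 W) = (w < W) by rewrite mem_iota add0n.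
apply/hasP/hasP => [[w Hw /andP [e1]]|[w' Hw' /andP [/hasP [w Hw /andP [e1 H1]] H2]]].
  rewrite IH //; last by rewrite -I.
  case/hasP=> w' Hw' /andP [H1 H2]; exists w' => //.
  by rewrite H2 andbT; apply/hasP; exists w => //; rewrite e1.
exists w => //; rewrite e1 IH //; last by rewrite -I.
by apply/hasP; exists w' => //; apply/andP.
Qed.

Definition edges (l1 l2 : seq tree) :=
  [seq (fun u v => leafbit p.1 u v && leafbit p.2 u v) | p <- zip l1 l2].

(** The middle node of the recursion is where the walk passes from the left half of the leaves to
    the right half. *)
Lemma reach_walk d tx ty u v : u < W -> v < W ->
  reach W d tx ty u v = walk (edges (leaves d tx) (leaves d ty)) u v.
Proof.
elim: d tx ty u v => [|d IH] tx ty u v ltu ltv /=.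
  apply/idP/hasP => [H|[w _ /andP [H /eqP <-]]] //.
  by exists v; [rewrite mem_iota|rewrite H eqxx].
rewrite /edges zip_cat ?size_leaves // map_cat walk_cat //.
by apply: eq_in_has => w; rewrite mem_iota add0n => /andP [_ ltw]; rewrite !IH.
Qed.

(** A padding layer can be left only from node 0 and the walk ends at 0, so every node on it is
    0. *)
Lemma walk_stop es : 0 < W ->
  (forall e, List.In e es -> forall u v, u < W -> v < W -> e u v = (u == 0)) ->
  forall u, u < W -> walk es u 0 = (u == 0).
Proof.
move=> W0; elim: es => //= e es IH H u ltu.
have {}IH : forall u, u < W -> walk es u 0 = (u == 0).
  by move=> w ltw; apply: IH => // e' He'; apply: H; right.
apply/hasP/idP => [[w]|/eqP ->].
  by rewrite mem_iota => /andP [_ ltw] /andP []; rewrite H //; left.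
by exists 0; [rewrite mem_iota|rewrite H ?IH //; left].
Qed.

Lemma walk_padded es1 es2 u : u < W ->
  (forall e, List.In e es2 -> forall u v, u < W -> v < W -> e u v = (u == 0)) ->
  walk (es1 ++ es2) u 0 = walk es1 u 0.
Proof.
move=> ltu H; have W0 : 0 < W by lia.
rewrite -[es1 in RHS]cats0 !walk_cat //.
apply: eq_in_has => w; rewrite mem_iota add0n => /andP [_ ltw].
by rewrite (walk_stop W0 H).
Qed.
End Paths.

Lemma accepts_walk n T W (P : bp n T.+1 W.+1) (x : n.-tuple bool)
    (e : 'I_T -> nat -> nat -> bool) :
  (forall (i : 'I_T) (u v : 'I_W.+1), e i u v = bp_edge P i u (tnth x (bp_var P i)) v) ->
  walk W.+1 [seq e i | i <- enum 'I_T] 0 0 = bp_accepts P x.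
Proof.
(* Generalised to an arbitrary node of layer [i], for induction on the number of remaining
   layers. *)
move=> He; suff H k i (lei : i < T.+1) (u : 'I_W.+1) : T - i = k ->
    walk W.+1 [seq e j | j <- drop i (enum 'I_T)] u 0
      = connect (bp_usable P x) (Ordinal lei, u) (bp_acc T W).
  by have := H T 0 (ltn0Sn T) ord0 (subn0 T); rewrite drop0 => ->;
     have -> : Ordinal (ltn0Sn T) = ord0 by apply: val_inj.
elim: k i lei u => [|k IH] i lei u Ek.
  have Ei : i = T by lia.
  rewrite drop_oversize ?size_enum_ord ?Ei //=; apply/eqP/idP => [u0|].
    suff -> : (Ordinal lei, u) = bp_acc T W by apply: connect0.
    by congr pair; apply: val_inj.
  case/connectP=> [[|y p] /=]; first by move=> _ /(congr1 snd) /= <-.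
  by case/andP => /existsP [j /and3P [/eqP /= Ej _ _]]; have /= := ltn_ord j; rewrite -Ej Ei ltnn.
have ltT : i < T by lia.
have Sle : i.+1 < T.+1 by [].
have {}IH := IH _ Sle.
rewrite (drop_nth (Ordinal ltT)) ?size_enum_ord // map_cons walk_cons.
have -> : nth (Ordinal ltT) (enum 'I_T) i = Ordinal ltT.
  by apply: val_inj; rewrite /= nth_enum_ord.
apply/hasP/idP => [[w]|].
  rewrite mem_iota add0n => /andP [_ ltw] /andP [eu Hw].
  apply: (@connect_trans _ _ (Ordinal Sle, Ordinal ltw)).
    apply: connect1; apply/existsP; exists (Ordinal ltT).
    by rewrite /= !eqxx /= -He.
  by rewrite -(IH (Ordinal ltw)) //; lia.
case/connectP=> [[|[y w] p] /=]; first by move=> _ /(congr1 (fun z => val z.1)) /= Ei; lia.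
case/andP=> /existsP [j /and3P [/eqP /= Ej /eqP /= Ey Hj]] Hp El.
have {}Ej : j = Ordinal ltT by apply: val_inj.
have Ey' : y = Ordinal Sle by apply: val_inj; rewrite /= Ey Ej.
subst y j; exists (val w); first by rewrite (mem_iota 0 W.+1) add0n ltn_ord.
rewrite (He (Ordinal ltT) u w) Hj IH //; last by lia.
by apply/connectP; exists p.
Qed.

(* Until it is resolved, the status of a layer is the number of variables to be
   processed before its own. *)
Definition resolved tau := Node (Node Leaf Leaf) tau.
Definition choice_tag b := Node Leaf (tree_of_bool b).
Definition pad_item := Node (resolved (Node (Node Leaf Leaf) Leaf)) Leaf.

(** The left child of the status separates the cases: it is [Leaf] in a nonzero counter and a [Node]
    once resolved, so a resolved item is left unchanged. *)
Definition step (tau it : tree) : tree :=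
  match it with
  | Node Leaf M => Node (resolved tau) M
  | Node (Node Leaf c) M => Node c M
  | _ => it
  end.

(* One side owns the even variables and the other side the odd ones; [flag] tells
   whether the next variable is owned. *)
Fixpoint enum_half d flag n t : seq tree := if n is n'.+1 then
    if flag then enum_half d false n' (map_tree (step (choice_tag false)) d t) ++
                 enum_half d false n' (map_tree (step (choice_tag true)) d t)
    else enum_half d true n' (map_tree (step Leaf) d t)
  else [:: t].

Fixpoint run flag n (x : nat -> bool) it := if n is n'.+1 then
    run (~~ flag) n' (x \o S) (step (if flag then choice_tag (x 0) else Leaf) it)
  else it.

(** With the converse below, the enumeration is exactly the set of half assignments. [x] is total
    for convenience; [run] ignores its values at variables owned by the other side. *)
Lemma enum_half_run d flag n t t' : List.In t' (enum_half d flag n t) ->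
  exists x, leaves d t' = map (run flag n x) (leaves d t).
Proof.
elim: n flag t => [|n IH] flag t /=; first by case=> // <-; exists xpred0; rewrite map_id.
have E b : List.In t' (enum_half d (~~ flag) n
    (map_tree (step (if flag then choice_tag b else Leaf)) d t)) ->
    exists x, leaves d t' = map (run flag n.+1 x) (leaves d t).
  case/IH => x ->; exists (fun i => if i is j.+1 then x j else b).
  by rewrite leaves_map -map_comp.
by case: flag E => /= E; rewrite ?List.in_app_iff; [case; apply: E|apply: (E false)].
Qed.

Lemma run_enum_half d flag n t x :
  exists2 t', List.In t' (enum_half d flag n t) & leaves d t' = map (run flag n x) (leaves d t).
Proof.
elim: n flag t x => [|n IH] flag t x /=.
  by exists t; [left|rewrite map_id].
have [t' Ht' E] := IH (~~ flag) (map_tree (step (if flag then choice_tag (x 0) else Leaf)) d t) (x \o S).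
exists t'; last by rewrite E leaves_map -map_comp.
by case: flag Ht' {E} => //=; rewrite List.in_app_iff; case: (x 0); auto.
Qed.

Lemma run_resolved flag n x tau M : run flag n x (Node (resolved tau) M) = Node (resolved tau) M.
Proof. by elim: n flag x => //= n IH flag x; rewrite IH. Qed.

Lemma run_var flag n x c M : c < n -> run flag n x (Node (tree_of_nat c) M) =
  Node (resolved (if flag (+) odd c then choice_tag (x c) else Leaf)) M.
Proof.
elim: n flag x c => // n IH flag x [|c] ltc /=.
  by rewrite addbF run_resolved.
by rewrite IH //= addNb addbN.
Qed.

(** Returns a complete tree of depth [d] paired with the unread part of the list. At depth 0 a list
    cell already is such a pair. *)
Fixpoint build d (l : tree) : tree := if d is d'.+1 then
    let p := build d' l in let q := build d' (rgt p) in
    Node (Node (lft p) (lft q)) (rgt q)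
  else if l is Node _ _ then l else Node pad_item Leaf.

Lemma buildP d s : leaves d (lft (build d (tree_of_seq s))) =
    take (2 ^ d) s ++ nseq (2 ^ d - size s) pad_item /\
  rgt (build d (tree_of_seq s)) = tree_of_seq (drop (2 ^ d) s).
Proof.
elim: d s => [|d IH] s; first by case: s => //= a s; rewrite take0 drop0.
have [L1 R1] := IH s; have [L2 R2] := IH (drop (2 ^ d) s).
rewrite /= L1 R1 L2 R2 expnS mul2n -addnn drop_drop; split=> //.
rewrite size_drop; case: (leqP (size s) (2 ^ d)) => les.
  have le2 : size s <= 2 ^ d + 2 ^ d by lia.
  rewrite (take_oversize les) (take_oversize le2) (drop_oversize les) /=.
  by rewrite -catA -nseqD; congr (_ ++ nseq _ _); lia.
rewrite (_ : 2 ^ d - size s = 0) ?cats0; last by lia.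
by rewrite catA -takeD; congr (_ ++ nseq _ _); lia.
Qed.

Lemma nth_tree_seq s i : nth_tree (tree_of_seq s) i = nth Leaf s i.
Proof. by elim: s i => [|a s IH] [|i] //=; elim: i. Qed.

Lemma edges_map (f g : tree -> tree) l : edges (map f l) (map g l) =
  [seq (fun u v => leafbit (f a) u v && leafbit (g a) u v) | a <- l].
Proof. by elim: l => //= a l <-. Qed.

Definition layer_tree n T W (P : bp n T W) i :=
  Node (tree_of_nat (bp_var P i))
    (tree_of_seq [seq tree_of_seq
      [seq Node (tree_of_bool (bp_edge P i j false j'))
                (tree_of_bool (bp_edge P i j true j')) | j' <- enum 'I_W] | j <- enum 'I_W]).

Lemma leafbit_layer n T W (P : bp n T W) i flag x (u v : 'I_W) :
  leafbit (run flag n x (layer_tree P i)) u v =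
  if flag (+) odd (bp_var P i) then bp_edge P i u (x (bp_var P i)) v else true.
Proof.
rewrite run_var //; case: (flag (+) _) => //=.
rewrite /leafbit /= nth_tree_seq (nth_map u) ?size_enum_ord // nth_ord_enum.
rewrite nth_tree_seq (nth_map v) ?size_enum_ord // nth_ord_enum /=.
by case: (x _) => /=; case: (bp_edge _ _ _ _ _).
Qed.

Definition layers_tree n T W (P : bp n T W) D :=
  lft (build D (tree_of_seq [seq layer_tree P i | i <- enum 'I_T.-1])).

Lemma reach_accepts n T W (P : bp n T.+1 W.+1) D tx ty x y (z : n.-tuple bool) : T <= 2 ^ D ->
  leaves D tx = map (run true n x) (leaves D (layers_tree P D)) ->
  leaves D ty = map (run false n y) (leaves D (layers_tree P D)) ->
  (forall i, tnth z i = if odd i then y i else x i) ->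
  reach W.+1 D tx ty 0 0 = bp_accepts P z.
Proof.
move=> leT Ex Ey Ez; rewrite reach_walk // Ex Ey edges_map.
have [-> _] := buildP D [seq layer_tree P i | i <- enum 'I_T].
have sz : size [seq layer_tree P i | i <- enum 'I_T] = T by rewrite size_map size_enum_ord.
rewrite take_oversize ?sz // map_cat walk_padded //; last first.
  move=> e; rewrite map_nseq => H u v _ _.
  have -> : e = fun u v => leafbit (run true n x pad_item) u v && leafbit (run false n y pad_item) u v.
    by elim: (_ - _) H => //= j IH [].
  by rewrite /pad_item !run_resolved /leafbit /= andbb.
rewrite -map_comp; apply: accepts_walk => i u v /=.
(* By parity exactly one side owns the variable of a layer; the other contributes [true]. *)
rewrite !leafbit_layer Ez; case: (odd _) => //=; exact: andbT.
Qed.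

Lemma sat_reach n T W (P : bp n T.+1 W.+1) D : T <= 2 ^ D ->
  bp_sat P <-> exists t u, [/\ List.In t (enum_half D true n (layers_tree P D)),
    List.In u (enum_half D false n (layers_tree P D)) & reach W.+1 D t u 0 0].
Proof.
move=> leT; split=> [[z acc]|[t [u [/enum_half_run [x Ex] /enum_half_run [y Ey] r]]]].
  have [t tin Et] := run_enum_half D true n (layers_tree P D) (nth false z).
  have [u uin Eu] := run_enum_half D false n (layers_tree P D) (nth false z).
  exists t, u; split=> //; rewrite (reach_accepts leT Et Eu (z := z)) // => i.
  by rewrite (tnth_nth false) if_same.
exists [tuple if odd i then y i else x i | i < n].
by rewrite -(reach_accepts leT Ex Ey) // => i; rewrite tnth_mktuple.
Qed.

Lemma size_enum_half d flag n t : size (enum_half d flag n t) = 2 ^ (n + flag)./2.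
Proof.
elim: n flag t => [|n IH] [] t //=.
  by rewrite size_cat !IH addn0 addn1 /= expnS mul2n addnn.
by rewrite IH addn0 addn1.
Qed.

(** * The program *)

(** The string generators of the program receive the tail of their output and prepend to it, which
    avoids copying finished gadgets. *)
Definition prepend (s : seq bool) (t : tree) := foldr (fun b => Node (tree_of_bool b)) t s.

Lemma prepend_cat s1 s2 t : prepend (s1 ++ s2) t = prepend s1 (prepend s2 t).
Proof. exact: foldr_cat. Qed.

Lemma tree_of_bitsE s : tree_of_bits s = prepend s Leaf.
Proof. by rewrite /tree_of_bits /tree_of_seq foldr_map. Qed.

Lemma tree_of_seq0 : tree_of_seq [::] = Leaf. Proof. by []. Qed.
Lemma tree_of_seqS a s : tree_of_seq (a :: s) = Node a (tree_of_seq s). Proof. by []. Qed.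
Lemma tree_of_natS n : tree_of_nat n.+1 = Node Leaf (tree_of_nat n). Proof. by []. Qed.
Lemma tree_of_nat0 : tree_of_nat 0 = Leaf. Proof. by []. Qed.
(* A unary number is also a list of zero bits. *)
Lemma tree_of_natE n : tree_of_nat n = prepend (rep0 n) Leaf.
Proof. by elim: n => //= n <-. Qed.

Definition fstE e := ECase e ELeaf (EVar 0).
Definition sndE e := ECase e ELeaf (EVar 1).
Definition succE e := ENode ELeaf e.
Definition litE n := iter n succE ELeaf.
(* [argE d i] and [restE d i] are the [i]-th component and what follows the
   first [i] components of the right-nested tuple held by variable [d]. *)
Definition restE d i := iter i sndE (EVar d).
Definition argE d i := fstE (restE d i).

(* Positions of the functions in the program; the entry point has position 0. *)
Definition F_app := 1.
Definition F_mul := 2.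
Definition F_shl := 3.
Definition F_half := 4.
Definition F_lg := 5.
Definition F_rep1 := 6.
Definition F_nth := 7.
Definition F_leafbit := 8.
Definition F_gadgetX := 9.
Definition F_gadgetX_loop := 10.
Definition F_gadgetY := 11.
Definition F_gadgetY_loop := 12.
Definition F_gain := 13.
Definition F_scales := 14.
Definition F_step := 15.
Definition F_build := 16.
Definition F_enumX := 17.
Definition F_enumY := 18.
Definition F_zeros := 19.
Definition F_ones := 20.
Definition F_drop := 21.
Definition F_len := 22.

Notation "f @( e1 , .. , e2 , e3 )" :=
  (ECall f (ENode e1 .. (ENode e2 e3) ..)) (at level 0, e1, e2, e3 at level 99).

Definition trueE := ENode ELeaf ELeaf.

Definition body_app :=
  ECase (argE 0 0) (restE 0 1) (ENode (EVar 0) (F_app @(EVar 1, restE 2 1))).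
Definition body_mul :=
  ECase (argE 0 0) ELeaf (F_app @(restE 2 1, F_mul @(EVar 1, restE 2 1))).
Definition body_shl :=
  ECase (argE 0 0) (restE 0 1) (F_shl @(EVar 1, F_app @(restE 2 1, restE 2 1))).
Definition body_half :=
  ECase (EVar 0) ELeaf (ECase (EVar 1) ELeaf (succE (ECall F_half (EVar 1)))).
Definition body_lg :=
  ECase (EVar 0) ELeaf (succE (ECall F_lg (ECall F_half (EVar 2)))).
Definition body_rep1 :=
  ECase (argE 0 0) (restE 0 1) (ENode trueE (F_rep1 @(EVar 1, restE 2 1))).
Definition body_nth :=
  ECase (restE 0 1) (fstE (argE 0 0)) (F_nth @(sndE (argE 2 0), EVar 1)).
Definition to_boolE e := ECase e ELeaf trueE.
Definition body_leafbit :=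
  ECase (sndE (fstE (argE 0 0))) trueE
    (ECase (EVar 0)
       (ECase (EVar 1)
          (to_boolE (fstE (F_nth @(F_nth @(sndE (argE 2 0), argE 2 1), restE 2 2))))
          (to_boolE (sndE (F_nth @(F_nth @(sndE (argE 4 0), argE 4 1), restE 4 2)))))
       (ECase (argE 4 1) trueE ELeaf)).

Definition bitsE s e := foldr (fun b : bool => ENode (if b then trueE else ELeaf)) e s.
Definition oddE e := succE (F_app @(e, e)).
(* [2 W + 5] *)
Definition sepE e := succE (succE (succE (succE (oddE e)))).

(* argument: (scales, (W, (t, (u, (v, rest))))) *)
Definition body_gadgetX :=
  ECase (argE 0 0)
    (ECase (F_leafbit @(argE 0 2, argE 0 3, argE 0 4))
       (bitsE (leafx false) (restE 0 5)) (bitsE (leafx true) (restE 2 5)))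
    (F_gadgetX_loop @(argE 2 1, litE 0, EVar 0, EVar 1, argE 2 1, argE 2 2, argE 2 3, argE 2 4, restE 2 5)).

(* argument: (remaining, (done, (k, (scales, (W, (t, (u, (v, rest)))))))) *)
Definition body_gadgetX_loop :=
  let k := argE 2 2 in
  let gadget t u v e := F_gadgetX @(argE 2 3, argE 2 4, t, u, v, e) in
  ECase (argE 0 0) (restE 0 8)
   (F_rep1 @(k, F_app @(F_mul @(oddE (argE 2 1), k),
     gadget (fstE (argE 2 5)) (argE 2 6) (EVar 1) (F_app @(k,
     gadget (sndE (argE 2 5)) (EVar 1) (argE 2 7) (F_app @(F_mul @(oddE (EVar 1), k),
     F_rep1 @(k, F_app @(F_mul @(sepE (argE 2 4), k),
     F_gadgetX_loop @(EVar 1, succE (argE 2 1), restE 2 2)))))))))).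

Definition body_gadgetY :=
  let K := F_mul @(F_app @(argE 2 1, argE 2 1), F_mul @(sepE (argE 2 1), EVar 0)) in
  ECase (argE 0 0)
    (ECase (F_leafbit @(argE 0 2, argE 0 3, argE 0 4))
       (bitsE (leafy false) (restE 0 5)) (bitsE (leafy true) (restE 2 5)))
    (F_app @(K, F_rep1 @(EVar 0,
     F_gadgetY_loop @(argE 2 1, EVar 0, EVar 1, argE 2 1, argE 2 2, argE 2 3, argE 2 4,
       F_app @(EVar 0, F_rep1 @(EVar 0, F_app @(K, restE 2 5))))))).

(* argument: (remaining, (k, (scales, (W, (t, (u, (v, rest))))))) *)
Definition body_gadgetY_loop :=
  let k := argE 2 1 in
  let gadget t u v e := F_gadgetY @(argE 2 2, argE 2 3, t, u, v, e) in
  ECase (argE 0 0) (restE 0 7)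
   (F_app @(k, gadget (fstE (argE 2 4)) (argE 2 5) (EVar 1) (F_app @(k,
     gadget (sndE (argE 2 4)) (EVar 1) (argE 2 6) (F_gadgetY_loop @(EVar 1, restE 2 1)))))).

Definition body_gain :=
  ECase (EVar 0) (litE 1) (ELet (ECall F_gain (EVar 1))
    (succE (F_app @(EVar 1, F_app @(EVar 1, F_app @(EVar 0, EVar 0)))))).

(* argument: (d, (growth, (k, scales))) *)
Definition body_scales :=
  ECase (argE 0 0) (restE 0 2)
    (F_scales @(EVar 1, argE 2 1, F_mul @(argE 2 1, argE 2 2), restE 2 2)).

(* argument: (d, (tag, t)) *)
Definition body_step :=
  ECase (argE 0 0)
    (ECase (restE 0 2) ELeaf
      (ECase (EVar 0)
        (ENode (ENode trueE (argE 2 1)) (EVar 1))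
        (ECase (EVar 0) (ENode (EVar 1) (EVar 3)) (restE 6 2))))
    (ENode (F_step @(EVar 1, argE 2 1, fstE (restE 2 2)))
           (F_step @(EVar 1, argE 2 1, sndE (restE 2 2)))).

Definition body_build :=
  ECase (argE 0 0)
    (ECase (restE 0 1) (ENode (ENode (ENode trueE (ENode trueE ELeaf)) ELeaf) ELeaf) (restE 2 1))
    (ELet (F_build @(EVar 1, restE 2 1)) (ELet (F_build @(EVar 2, sndE (EVar 0)))
       (ENode (ENode (fstE (EVar 1)) (fstE (EVar 0))) (sndE (EVar 0))))).

Definition shl2E e := F_shl @(litE 2, e).
Definition shl4E e := F_shl @(litE 4, e).

(* argument of both enumerators:
   (n, (flag, (t, (d, (scale, (null_gain, (scales, (W, rest)))))))) *)
Definition body_enum self leaf :=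
  ECase (argE 0 0) leaf
    (ECase (argE 2 1)
      (self @(EVar 1, trueE, F_step @(argE 2 3, ELeaf, argE 2 2), restE 2 3))
      (self @(EVar 3, ELeaf, F_step @(argE 4 3, ENode ELeaf ELeaf, argE 4 2),
         argE 4 3, argE 4 4, argE 4 5, argE 4 6, argE 4 7,
         self @(EVar 3, ELeaf, F_step @(argE 4 3, ENode ELeaf trueE, argE 4 2), restE 4 3)))).

Definition body_enumX := body_enum F_enumX
  (F_rep1 @(argE 0 5, F_app @(shl2E (argE 0 4), F_rep1 @(argE 0 4, F_app @(argE 0 4,
     F_gadgetX @(argE 0 6, argE 0 7, argE 0 2, litE 0, litE 0, F_app @(shl2E (argE 0 4), restE 0 8))))))).

Definition body_enumY := body_enum F_enumY
  (F_app @(shl4E (argE 0 4), F_rep1 @(argE 0 5, F_app @(argE 0 4,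
     F_gadgetY @(argE 0 6, argE 0 7, argE 0 2, litE 0, litE 0, F_app @(shl4E (argE 0 4), restE 0 8)))))).

Definition body_zeros :=
  ECase (EVar 0) ELeaf
   (ECase (EVar 0) (succE (ECall F_zeros (EVar 1))) (ECall F_zeros (EVar 3))).
Definition body_ones :=
  ECase (EVar 0) ELeaf
   (ECase (EVar 0) (ECall F_ones (EVar 1)) (succE (ECall F_ones (EVar 3)))).
Definition body_drop :=
  ECase (restE 0 1) (argE 0 0) (F_drop @(sndE (argE 2 0), EVar 1)).
Definition body_len :=
  ECase (EVar 0) ELeaf (succE (ECall F_len (EVar 1))).

Definition library := [:: body_app; body_mul; body_shl; body_half; body_lg; body_rep1;
  body_nth; body_leafbit; body_gadgetX; body_gadgetX_loop; body_gadgetY; body_gadgetY_loop; body_gain; body_scales;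
  body_step; body_build; body_enumX; body_enumY; body_zeros; body_ones; body_drop; body_len].

(** * Evaluation with upper bounds on the number of steps *)

Section Semantics.
Variable main : expr.
Let p := main :: library.

Definition evals env e v K := exists2 k, Defs.eval p env e v k & k <= K.
Definition calls f a v K :=
  exists2 k, exists2 body, onth p f = Some body & Defs.eval p [:: a] body v k & k <= K.

Lemma evals_eq env e v v' K K' : evals env e v K -> v = v' -> K <= K' -> evals env e v' K'.
Proof. by case=> k H le <- le'; exists k => //; apply: leq_trans le'. Qed.

Lemma calls_eq f a v v' K K' : calls f a v K -> v = v' -> K <= K' -> calls f a v' K'.
Proof. by case=> k H le <- le'; exists k => //; apply: leq_trans le'. Qed.

Lemma calls_body f body a v K : onth p f = Some body -> evals [:: a] body v K -> calls f a v K.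
Proof. by move=> E [k H le]; exists k => //; exists body. Qed.

Lemma ev_var env i v : onth env i = Some v -> evals env (EVar i) v 1.
Proof. by move=> H; exists 1 => //; apply: eval_var. Qed.

Lemma ev_leaf env : evals env ELeaf Leaf 1.
Proof. by exists 1 => //; apply: eval_leaf. Qed.

Lemma ev_node env e1 e2 v1 v2 K1 K2 : evals env e1 v1 K1 -> evals env e2 v2 K2 ->
  evals env (ENode e1 e2) (Node v1 v2) (K1 + K2 + 1).
Proof.
by move=> [k1 H1 l1] [k2 H2 l2]; exists (k1 + k2).+1; [apply: eval_node|lia].
Qed.

Lemma ev_case env e e0 e1 v0 v K1 K2 : evals env e v0 K1 ->
  (match v0 with Leaf => evals env e0 v K2 | Node a b => evals [:: a, b & env] e1 v K2 end) ->
  evals env (ECase e e0 e1) v (K1 + K2 + 1).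
Proof.
move=> [k1 H1 l1]; case: v0 H1 => [|a b] H1 [k2 H2 l2]; exists (k1 + k2).+1; try lia.
- exact: eval_case_leaf H2.
- exact: eval_case_node H1 H2.
Qed.

Lemma ev_let env e1 e2 v1 v K1 K2 : evals env e1 v1 K1 -> evals (v1 :: env) e2 v K2 ->
  evals env (ELet e1 e2) v (K1 + K2 + 1).
Proof.
by move=> [k1 H1 l1] [k2 H2 l2]; exists (k1 + k2).+1; [apply: eval_let H1 H2|lia].
Qed.

Lemma ev_call env f e v1 v K1 K2 : evals env e v1 K1 -> calls f v1 v K2 ->
  evals env (ECall f e) v (K1 + K2 + 1).
Proof.
move=> [k1 H1 l1] [k2 [body E H2] l2].
by exists (k1 + k2).+1; [apply: eval_call E H1 H2|lia].
Qed.

Lemma ev_fst env e v r K : evals env e v K -> lft v = r -> evals env (fstE e) r (K + 2).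
Proof.
move=> H <-; apply: evals_eq (ev_case (v := lft v) (K2 := 1) H _) _ _ => //; last by lia.
by case: v {H} => [|a b]; [apply: ev_leaf|apply: ev_var].
Qed.

Lemma ev_snd env e v r K : evals env e v K -> rgt v = r -> evals env (sndE e) r (K + 2).
Proof.
move=> H <-; apply: evals_eq (ev_case (v := rgt v) (K2 := 1) H _) _ _ => //; last by lia.
by case: v {H} => [|a b]; [apply: ev_leaf|apply: ev_var].
Qed.

Lemma ev_succ env e n K : evals env e (tree_of_nat n) K ->
  evals env (succE e) (tree_of_nat n.+1) (K + 2).
Proof. by move=> H; apply: evals_eq (ev_node (ev_leaf _) H) _ _; rewrite ?tree_of_natS //; lia. Qed.

Lemma ev_lit env n : evals env (litE n) (tree_of_nat n) (2 * n + 1).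
Proof.
elim: n => [|n IH]; first exact: ev_leaf.
by apply: evals_eq (ev_succ IH) _ _ => //; lia.
Qed.

Lemma ev_bits env s e v K : evals env e v K ->
  evals env (bitsE s e) (prepend s v) (K + 4 * size s).
Proof.
move=> H; elim: s => [|b s IH] /=; first by apply: evals_eq H _ _ => //; lia.
have Hb : evals env (if b then trueE else ELeaf) (tree_of_bool b) 3.
  case: b; first exact: ev_node (ev_leaf _) (ev_leaf _).
  by apply: evals_eq (ev_leaf _) _ _.
by apply: evals_eq (ev_node Hb IH) _ _ => //; lia.
Qed.
Lemma ev_to_bool env e t K : evals env e t K ->
  evals env (to_boolE e) (tree_of_bool (is_node t)) (K + 4).
Proof.
move=> H; apply: evals_eq (ev_case (v := tree_of_bool (is_node t)) (K2 := 3) H _) _ _ => //; last by lia.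
case: t {H} => [|a b] /=; first by apply: evals_eq (ev_leaf _) _ _.
by apply: evals_eq (ev_node (ev_leaf _) (ev_leaf _)) _ _.
Qed.

End Semantics.

Create HintDb calls.

(** Follows the syntax of an expression and leaves its value and cost as existential variables;
    calls are closed by the lemmas in the hint database. *)
Ltac ev :=
  lazymatch goal with
  | |- evals _ _ (argE _ _) _ _ => unfold argE; ev
  | |- evals _ _ (restE _ _) _ _ => unfold restE; cbn [iter]; ev
  | |- evals _ _ (fstE _) _ _ => eapply ev_fst; [ev|cbn [lft]; reflexivity]
  | |- evals _ _ (sndE _) _ _ => eapply ev_snd; [ev|cbn [rgt]; reflexivity]
  | |- evals _ _ (succE _) _ _ => eapply ev_succ; ev
  | |- evals _ _ (litE _) _ _ => eapply ev_lit
  | |- evals _ _ (bitsE _ _) _ _ => eapply ev_bits; ev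
  | |- evals _ _ trueE _ _ => unfold trueE; ev
  | |- evals _ _ (oddE _) _ _ => unfold oddE; ev
  | |- evals _ _ (sepE _) _ _ => unfold sepE; ev
  | |- evals _ _ (to_boolE _) _ _ => eapply ev_to_bool; ev
  | |- evals _ _ (shl2E _) _ _ => unfold shl2E; ev
  | |- evals _ _ (shl4E _) _ _ => unfold shl4E; ev
  | |- evals _ _ (EVar _) _ _ => eapply ev_var; reflexivity
  | |- evals _ _ ELeaf _ _ => eapply ev_leaf
  | |- evals _ _ (ENode _ _) _ _ => eapply ev_node; [ev|ev]
  | |- evals _ _ (ECase _ _ _) _ _ => eapply ev_case; [ev|cbn beta iota; ev]
  | |- evals _ _ (ELet _ _) _ _ => eapply ev_let; [ev|ev]
  | |- evals _ _ (ECall _ _) _ _ => eapply ev_call; [ev|solve [eauto with calls nocore]]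
  | |- _ => idtac
  end.

Ltac run body := eapply calls_eq; [eapply calls_body; [reflexivity|unfold body; ev]| |].

(** * Correctness and running time of the library functions *)

Section Library.
Variable main : expr.
Notation calls := (calls main).

Lemma calls_app s t : calls F_app (Node (tree_of_seq s) t) (foldr Node t s) (15 * (size s).+1).
Proof.
elim: s => [|a s IH]; rewrite ?tree_of_seq0 ?tree_of_seqS; run body_app => //=; lia.
Qed.
Hint Resolve calls_app : calls.

Lemma calls_app_nat a b : calls F_app (Node (tree_of_nat a) (tree_of_nat b))
  (tree_of_nat (a + b)) (15 * a.+1).
Proof.
apply: calls_eq (calls_app (nseq a Leaf) _) _ _; last by rewrite size_nseq.
by elim: a => //= a ->.
Qed.

Lemma calls_app_rep0 a t : calls F_app (Node (tree_of_nat a) t)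
  (prepend (rep0 a) t) (15 * a.+1).
Proof.
apply: calls_eq (calls_app (nseq a Leaf) _) _ _; last by rewrite size_nseq.
by elim: a => //= a ->.
Qed.
Hint Resolve calls_app_nat | 1 : calls.
Hint Resolve calls_app_rep0 | 2 : calls.
Opaque tree_of_nat tree_of_seq prepend.

Lemma calls_mul a b : calls F_mul (Node (tree_of_nat a) (tree_of_nat b))
  (tree_of_nat (a * b)) (50 * (a.+1 * b.+1)).
Proof.
elim: a => [|a IH]; rewrite ?tree_of_nat0 ?tree_of_natS; run body_mul => //=; try lia.
Qed.
Hint Resolve calls_mul : calls.

Lemma calls_shl c a : calls F_shl (Node (tree_of_nat c) (tree_of_nat a))
  (tree_of_nat (a * 2 ^ c)) (60 * (a.+1 * 2 ^ c)).
Proof.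
(* The repeated doublings cost a geometric series, whose exact form is needed for the induction. *)
suff H : calls F_shl (Node (tree_of_nat c) (tree_of_nat a))
    (tree_of_nat (a * 2 ^ c)) (15 * (a * (2 ^ c).-1) + 40 * c + 20).
  apply: calls_eq H _ _ => //; have : c < 2 ^ c by apply: ltn_expl.
  by case: (2 ^ c) => //= k; nia.
elim: c a => [|c IH] a; rewrite ?tree_of_nat0 ?tree_of_natS; run body_shl => //=.
- by rewrite expn0 muln1.
- by lia.
- by rewrite expnS addnn -muln2 mulnA.
- have : 0 < 2 ^ c by rewrite expn_gt0.
  rewrite expnS => p2; have -> : (2 * 2 ^ c).-1 = (2 ^ c).-1 + (2 ^ c).-1 + 1 by lia.
  by move: (2 ^ c).-1 => q; lia.
Qed.
Hint Resolve calls_shl : calls.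

Lemma calls_half a : calls F_half (tree_of_nat a) (tree_of_nat a./2) (20 * a.+1).
Proof.
have [n] := ubnP a; elim: n a => // n IH [|[|a]] lea; rewrite /= ?tree_of_natS ?tree_of_nat0.
- by run body_half.
- by run body_half.
- by have {}IH := IH a (ltnW lea); run body_half => //; lia.
Qed.
Hint Resolve calls_half : calls.

Fixpoint lg_fuel k n := if k is k'.+1 then if n is 0 then 0 else (lg_fuel k' n./2).+1 else 0.
Definition lg n := lg_fuel n n.

Lemma lg_fuel_enough k k' n : n <= k -> n <= k' -> lg_fuel k n = lg_fuel k' n.
Proof.
elim: k k' n => [|k IH] [|k'] [|n] //= lek lek'; congr _.+1; apply: IH; lia.
Qed.

Lemma lgE n : lg n.+1 = (lg n.+1./2).+1.
Proof. by rewrite /lg /=; congr _.+1; apply: lg_fuel_enough; lia. Qed.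

Lemma lg_bounds n : n < 2 ^ lg n <= 2 * n + (n == 0).
Proof.
have [m] := ubnP n; elim: m n => // m IH [|n] len; first by rewrite expn0.
have : n.+1./2 < 2 ^ lg n.+1./2 <= 2 * n.+1./2 + (n.+1./2 == 0) by apply: IH; lia.
rewrite lgE expnS; lia.
Qed.

Lemma calls_lg a : calls F_lg (tree_of_nat a) (tree_of_nat (lg a)) (100 * a.+1).
Proof.
have [n] := ubnP a; elim: n a => // n IH [|a] lea; first by rewrite tree_of_nat0; run body_lg.
have {}IH : calls F_lg (tree_of_nat a.+1./2) (tree_of_nat (lg a.+1./2)) (100 * a.+1./2.+1).
  by apply: IH; lia.
have Hh := calls_half a.+1; rewrite tree_of_natS in Hh.
rewrite lgE tree_of_natS; run body_lg => //; lia.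
Qed.
Hint Resolve calls_lg : calls.

Lemma calls_rep1 n t : calls F_rep1 (Node (tree_of_nat n) t) (prepend (rep1 n) t) (20 * n.+1).
Proof.
by elim: n => [|n IH]; rewrite ?tree_of_nat0 ?tree_of_natS; run body_rep1 => //; lia.
Qed.
Hint Resolve calls_rep1 : calls.

Lemma calls_nth l i : calls F_nth (Node l (tree_of_nat i)) (nth_tree l i) (20 * i.+1).
Proof.
by elim: i l => [|i IH] l; rewrite ?tree_of_nat0 ?tree_of_natS; run body_nth => //; lia.
Qed.
Hint Resolve calls_nth : calls.

Lemma calls_leafbit it u v : calls F_leafbit (Node it (Node (tree_of_nat u) (tree_of_nat v)))
  (tree_of_bool (leafbit it u v)) (20 * (u + v) + 150).
Proof.
case: it => [|[|h [|[|h' b'] b]] M]; try by run body_leafbit => //; lia.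
- by case: b => [|b b']; run body_leafbit => //; try (apply: ev_to_bool; ev);
    rewrite ?size_nseq //; lia.
- by case: u => [|u]; rewrite ?tree_of_nat0 ?tree_of_natS; run body_leafbit => //; lia.
Qed.
Hint Resolve calls_leafbit : calls.

(** This list of run lengths also serves the program as its recursion counter: it is [Leaf] exactly
    at depth 0. *)
Fixpoint scales_tree W d := if d is d'.+1 then
  Node (tree_of_nat (scale W d')) (scales_tree W d') else Leaf.

Lemma rev_iotaS r : rev (iota 0 r.+1) = r :: rev (iota 0 r).
Proof. by rewrite -addn1 iotaD rev_cat. Qed.

Section Gadgets.
Variables W d : nat.
Let k := scale W d.
Let C := 1000.

Lemma scale_gt0 : 0 < k.
Proof. by have := base_gt0 W d; have := base_scale W d; rewrite -/k; lia. Qed.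

Lemma calls_gadgetX_loop r dn t u v rest :
  (forall t u v rest, u < W -> v < W -> calls F_gadgetX
    (Node (scales_tree W d) (Node (tree_of_nat W) (Node t (Node (tree_of_nat u)
      (Node (tree_of_nat v) rest))))) (prepend (gadgetX W d t u v) rest) (C * base W d)) ->
  u < W -> v < W -> dn + r = W ->
  calls F_gadgetX_loop (Node (tree_of_nat r) (Node (tree_of_nat dn) (Node (tree_of_nat k)
    (Node (scales_tree W d) (Node (tree_of_nat W) (Node t (Node (tree_of_nat u)
      (Node (tree_of_nat v) rest))))))))
    (prepend (flatten [seq groupx W k w (gadgetX W d (lft t) u w) (gadgetX W d (rgt t) w v) ++
                 rep0 ((2 * W + 5) * k) | w <- rev (iota 0 r)]) rest)
    (r * (2 * (C * base W d) + C * ((2 * W + 5) * k)) + 100).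
Proof.
move=> Hgx ltu ltv; elim: r dn => [|r IH] dn Hd.
  by rewrite tree_of_nat0; run body_gadgetX_loop => //; lia.
have ltr : r < W by lia.
have {}IH : dn.+1 + r = W -> _ := IH dn.+1.
have {}IH := IH (etrans (addSnnS _ _) Hd).
rewrite tree_of_natS; run body_gadgetX_loop.
  rewrite rev_iotaS /= /groupx -!catA !prepend_cat.
  have -> : W.-1 - r = dn by lia.
  by do ![apply: (f_equal2 prepend); first by [|congr nseq; lia]].
have k0 := scale_gt0; have Wk : W * k = dn * k + r * k + k by rewrite -Hd; lia.
have dk : dn <= dn * k by rewrite leq_pmulr.
have rk : r <= r * k by rewrite leq_pmulr.
move: (base W d) => b.
rewrite /C; lia.
Qed.

Lemma calls_gadgetY_loop r t u v rest :
  (forall t u v rest, u < W -> v < W -> calls F_gadgetY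
    (Node (scales_tree W d) (Node (tree_of_nat W) (Node t (Node (tree_of_nat u)
      (Node (tree_of_nat v) rest))))) (prepend (gadgetY W d t u v) rest) (C * base W d)) ->
  u < W -> v < W -> r <= W ->
  calls F_gadgetY_loop (Node (tree_of_nat r) (Node (tree_of_nat k)
    (Node (scales_tree W d) (Node (tree_of_nat W) (Node t (Node (tree_of_nat u)
      (Node (tree_of_nat v) rest)))))))
    (prepend (flatten [seq blocky k (gadgetY W d (lft t) u w) (gadgetY W d (rgt t) w v)
       | w <- rev (iota 0 r)]) rest)
    (r * (2 * (C * base W d) + C * k) + 100).
Proof.
move=> Hgy ltu ltv; elim: r => [|r IH] ltr.
  by rewrite tree_of_nat0; run body_gadgetY_loop => //; lia.
have {}IH := IH (ltnW ltr).
rewrite tree_of_natS; run body_gadgetY_loop.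
  by rewrite rev_iotaS /= /blocky -!catA !prepend_cat.
have k0 := scale_gt0; move: (base W d) => b.
rewrite /C; lia.
Qed.
End Gadgets.

Lemma calls_gadgetX W d t u v rest : u < W -> v < W -> calls F_gadgetX
  (Node (scales_tree W d) (Node (tree_of_nat W) (Node t (Node (tree_of_nat u)
    (Node (tree_of_nat v) rest))))) (prepend (gadgetX W d t u v) rest) (1000 * base W d).
Proof.
elim: d t u v rest => [|d IH] t u v rest ltu ltv.
  (* The summand [W] in [base W 0] pays for walking to entry [(u, v)] of the adjacency matrix. *)
  have Hb : base W 0 = W + 4 by rewrite /base expn0 muln1.
  have Hl := calls_leafbit t u v.
  rewrite Hb /= in Hl *; case: (leafbit t u v) Hl => /= Hl; by run body_gadgetX => //; rewrite /=; lia.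
have Hl rest' : calls F_gadgetX_loop _ _ _ := calls_gadgetX_loop t rest' IH ltu ltv (add0n W).
rewrite [scales_tree W d.+1]/=; run body_gadgetX => //.
have := base_scale W d; have := scale_gt0 W d; rewrite baseS /scale.
move: (base W d) => b; nia.
Qed.

Lemma calls_gadgetY W d t u v rest : u < W -> v < W -> calls F_gadgetY
  (Node (scales_tree W d) (Node (tree_of_nat W) (Node t (Node (tree_of_nat u)
    (Node (tree_of_nat v) rest))))) (prepend (gadgetY W d t u v) rest) (1000 * base W d).
Proof.
elim: d t u v rest => [|d IH] t u v rest ltu ltv.
  have Hb : base W 0 = W + 4 by rewrite /base expn0 muln1.
  have Hl := calls_leafbit t u v.
  rewrite Hb /= in Hl *; case: (leafbit t u v) Hl => /= Hl; by run body_gadgetY => //; rewrite /=; lia.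
have Hl rest' : calls F_gadgetY_loop _ _ _ := calls_gadgetY_loop t rest' IH ltu ltv (leqnn W).
rewrite [scales_tree W d.+1]/=; run body_gadgetY.
  rewrite /= -!catA !prepend_cat.
  by do ![apply: (f_equal2 prepend); first by [|congr nseq; lia]].
have b2 : 2 * (W * base W d) <= scale W d by rewrite /scale; lia.
have := scale_gt0 W d; rewrite baseS.
have -> : (W + W).+1.+4 * scale W d = (2 * W + 5) * scale W d by lia.
have : (2 * W + 5) * scale W d = 2 * (W * scale W d) + 5 * scale W d by lia.
move: (base W d) (scale W d) b2 ((2 * W + 5) * scale W d) => b k b2 m Em k0.
have Wk : W <= W * k by rewrite leq_pmulr.
have Wm : m <= W * m by rewrite leq_pmull //; lia.
lia.
Qed.
Hint Resolve calls_gadgetX calls_gadgetY : calls.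

Lemma calls_gain W d : calls F_gain (scales_tree W d) (tree_of_nat (gain W d)) (100 * base W d).
Proof.
elim: d => [|d IH].
  by rewrite [scales_tree W 0]/=; run body_gain => //; rewrite /base expn0; lia.
rewrite [scales_tree W d.+1]/=; run body_gain.
  by congr tree_of_nat; rewrite /=; lia.
have := gain_base W d; have := base_scale W d; have := scale_gt0 W d.
have : 5 * scale W d <= base W d.+1.
  by rewrite baseS; apply: leq_trans (leq_pmull _ _); lia.
lia.
Qed.
Hint Resolve calls_gain : calls.

Lemma scaleS W d : scale W d.+1 = growth W * scale W d.
Proof. by rewrite /scale /base expnS; lia. Qed.

Lemma growth_ge W : 10 <= growth W. Proof. rewrite /growth; nia. Qed.

(** A step costs a constant times [scale W d.+1]. As scales grow by a factor of at least 10, the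
    increase of the subtracted term pays for it. *)
Lemma calls_scales W r d : calls F_scales
  (Node (tree_of_nat r) (Node (tree_of_nat (growth W))
    (Node (tree_of_nat (scale W d)) (scales_tree W d))))
  (Node (tree_of_nat (scale W (d + r))) (scales_tree W (d + r)))
  (400 * scale W (d + r) + 100 - 300 * scale W d).
Proof.
elim: r d => [|r IH] d.
  rewrite tree_of_nat0 addn0; run body_scales => //; lia.
have {}IH : calls F_scales
  (Node (tree_of_nat r) (Node (tree_of_nat (growth W))
    (Node (tree_of_nat (growth W * scale W d)) (Node (tree_of_nat (scale W d)) (scales_tree W d)))))
  (Node (tree_of_nat (scale W (d.+1 + r))) (scales_tree W (d.+1 + r)))
  (400 * scale W (d.+1 + r) + 100 - 300 * scale W d.+1) by rewrite -scaleS; apply: IH d.+1.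
have mono : scale W d.+1 <= scale W (d.+1 + r).
  by rewrite /scale /base !leq_mul2l leq_pexp2l ?leq_addr ?orbT // /growth; lia.
rewrite tree_of_natS -addSnnS; run body_scales => //.
move: mono; move: (scale W (d.+1 + r)) => K; rewrite scaleS.
have := growth_ge W; have := scale_gt0 W d; move: (growth W) (scale W d) => g k k0 g10.
have : 10 * k <= g * k by rewrite leq_mul2r g10 orbT.
have : g <= g * k by rewrite leq_pmulr.
lia.
Qed.

Lemma calls_step d tau t : calls F_step (Node (tree_of_nat d) (Node tau t))
  (map_tree (step tau) d t) (200 * 2 ^ d - 100).
Proof.
elim: d t => [|d IH] t.
  rewrite tree_of_nat0 expn0; case: t => [|[|[|? ?] ?] ?]; run body_step => //; lia.
have p2 : 0 < 2 ^ d by rewrite expn_gt0.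
by rewrite tree_of_natS expnS; run body_step => //; lia.
Qed.
Hint Resolve calls_step : calls.

Lemma calls_build d l : calls F_build (Node (tree_of_nat d) l) (build d l) (200 * 2 ^ d - 100).
Proof.
elim: d l => [|d IH] l.
  by rewrite tree_of_nat0 expn0; case: l => [|? ?]; run body_build => //; lia.
have p2 : 0 < 2 ^ d by rewrite expn_gt0.
by rewrite tree_of_natS expnS; run body_build => //; lia.
Qed.
Hint Resolve calls_build : calls.

Lemma prepend_cons b s t : prepend (b :: s) t = Node (tree_of_bool b) (prepend s t).
Proof. by []. Qed.
Lemma prepend_nil t : prepend [::] t = t. Proof. by []. Qed.

Lemma calls_zeros s : calls F_zeros (prepend s Leaf) (tree_of_nat (zeros s)) (30 * (size s).+1).
Proof.
by elim: s => [|[] s IH];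
  rewrite ?prepend_nil ?prepend_cons [count _ _]/= ?add0n ?add1n ?tree_of_nat0 /tree_of_bool;
  run body_zeros => //; rewrite /=; lia.
Qed.
Hint Resolve calls_zeros : calls.

Lemma calls_ones s : calls F_ones (prepend s Leaf) (tree_of_nat (ones s)) (30 * (size s).+1).
Proof.
by elim: s => [|[] s IH];
  rewrite ?prepend_nil ?prepend_cons [count _ _]/= ?add0n ?add1n ?tree_of_nat0 /tree_of_bool;
  run body_ones => //; rewrite /=; lia.
Qed.
Hint Resolve calls_ones : calls.

Lemma calls_len s : calls F_len (prepend s Leaf) (tree_of_nat (size s)) (30 * (size s).+1).
Proof.
by elim: s => [|b s IH]; rewrite ?prepend_nil ?prepend_cons ?tree_of_nat0; run body_len => //; rewrite /=; lia.
Qed.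
Hint Resolve calls_len : calls.

Lemma calls_drop s t : calls F_drop (Node (prepend s Leaf) (prepend t Leaf))
  (prepend (drop (size t) s) Leaf) (30 * (size t).+1).
Proof.
elim: t s => [|b t IH] s; rewrite ?prepend_nil ?prepend_cons ?drop0.
  by run body_drop => //; rewrite /=; lia.
have {}IH : calls F_drop (Node (rgt (prepend s Leaf)) (prepend t Leaf))
    (prepend (drop (size t).+1 s) Leaf) (30 * (size t).+1).
  by case: s => [|a s]; [have := IH [::]|apply: (IH s)].
by run body_drop => //; rewrite /=; lia.
Qed.

Lemma calls_drop_nat a b : calls F_drop (Node (tree_of_nat a) (tree_of_nat b))
  (tree_of_nat (a - b)) (30 * b.+1).
Proof.
rewrite !tree_of_natE; apply: calls_eq (calls_drop _ _) _ _; last by rewrite size_nseq.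
by rewrite size_nseq drop_nseq.
Qed.
Hint Resolve calls_drop calls_drop_nat : calls.

Lemma calls_app_bits s t : calls F_app (Node (prepend s Leaf) t) (prepend s t) (15 * (size s).+1).
Proof.
have -> : prepend s Leaf = tree_of_seq (map tree_of_bool s) by rewrite -tree_of_bitsE.
apply: calls_eq (calls_app _ _) _ _; last by rewrite size_map.
by rewrite foldr_map.
Qed.
Hint Resolve calls_app_bits : calls.

Section Enum.
Variables (self : nat) (leaf : expr) (F : tree -> seq bool) (d S g W E : nat) (ks : tree).
Hypothesis self_body : onth (main :: library) self = Some (body_enum self leaf).

Let arg n flag t rest := Node (tree_of_nat n) (Node (tree_of_bool flag) (Node t
  (Node (tree_of_nat d) (Node (tree_of_nat S) (Node (tree_of_nat g)
    (Node ks (Node (tree_of_nat W) rest))))))).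
Let B := 200 * 2 ^ d + 300.

Hypothesis leaf_evals : forall flag t rest,
  evals main [:: arg 0 flag t rest] leaf (prepend (F t) rest) E.

(* Branching levels alternate with levels that skip a variable; the subtracted
   term makes the bound go through the induction. *)
Lemma calls_enum n flag t rest : calls self (arg n flag t rest)
  (prepend (flatten [seq F t' | t' <- enum_half d flag n t]) rest)
  (2 ^ (n + flag)./2 * (E + 4 * B + 10) - (3 + flag) * B).
Proof.
elim: n flag t rest => [|n IH] flag t rest.
  have H := leaf_evals flag t rest.
  eapply calls_eq; [eapply calls_body; [exact: self_body|]| |].
  - rewrite /arg tree_of_nat0 in H *; eapply ev_case; first by ev.
    by cbn beta iota; exact: H.
  - by rewrite /= cats0.
  - by rewrite add0n; case: flag {H} => /=; rewrite ?expn0; lia.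
have p2 : 0 < 2 ^ d by rewrite expn_gt0.
have pn : 0 < 2 ^ n.+1./2 by rewrite expn_gt0.
have pn' : 0 < 2 ^ n./2 by rewrite expn_gt0.
case: flag; rewrite /arg tree_of_natS [tree_of_bool _]/=.
- have H0 rest' := IH false (map_tree (step (choice_tag false)) d t) rest'.
  have H1 rest' := IH false (map_tree (step (choice_tag true)) d t) rest'.
  rewrite /arg /choice_tag /= ?addn0 in H0 H1.
  eapply calls_eq; [eapply calls_body; [exact: self_body|unfold body_enum; ev]| |].
  + by rewrite /= map_cat flatten_cat prepend_cat.
  + have -> : (n.+1 + true)./2 = n./2.+1 by rewrite addn1.
    rewrite expnS; move: pn'; rewrite /B; move: (2 ^ n./2) => m; nia.
- have H0 rest' := IH true (map_tree (step Leaf) d t) rest'.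
  rewrite /arg /choice_tag /= ?addn1 in H0.
  eapply calls_eq; [eapply calls_body; [exact: self_body|unfold body_enum; ev]| |].
  + by [].
  + have -> : (n.+1 + false)./2 = n.+1./2 by rewrite addn0.
    move: pn; rewrite /B; move: (2 ^ n.+1./2) => m; nia.
Qed.
End Enum.

Lemma base_ge W d : 4 <= base W d.
Proof. by apply: leq_trans (leq_pmulr _ _); rewrite ?expn_gt0 /growth; lia. Qed.

Section Enumerators.
Variables W D : nat.
Hypothesis W_gt0 : 0 < W.
Let S := scale W D.
Let g := null_gain W D.
Let arg n flag t rest := Node (tree_of_nat n) (Node (tree_of_bool flag) (Node t
  (Node (tree_of_nat D) (Node (tree_of_nat S) (Node (tree_of_nat g)
    (Node (scales_tree W D) (Node (tree_of_nat W) rest))))))).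
Let cost := 4000 * S + 4 * (200 * 2 ^ D + 300) + 10.

Lemma calls_enumX n flag t rest : calls F_enumX (arg n flag t rest)
  (prepend (listX W D (enum_half D flag n t)) rest) (2 ^ (n + flag)./2 * cost).
Proof.
apply: calls_eq (@calls_enum _ _ (blockX W D) D S g W (4000 * S) _ _ _ n flag t rest) _ _;
  [by []| |by []|by rewrite /cost; lia].
move=> {n flag t rest} flag t rest.
have Hx := @calls_gadgetX W D t 0 0 _ W_gt0 W_gt0.
eapply evals_eq; [ev| |].
  rewrite /blockX /coreX -!catA !prepend_cat -/S -/g.
  by do ![apply: (f_equal2 prepend); first by [|congr nseq; lia]].
have := gain_le_scale W D; have := base_scale W D; have := base_ge W D.
rewrite -/S /g /null_gain -/S !expnS expn0; lia.
Qed.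

Lemma calls_enumY n flag t rest : calls F_enumY (arg n flag t rest)
  (prepend (listY W D (enum_half D flag n t)) rest) (2 ^ (n + flag)./2 * cost).
Proof.
apply: calls_eq (@calls_enum _ _ (blockY W D) D S g W (4000 * S) _ _ _ n flag t rest) _ _;
  [by []| |by []|by rewrite /cost; lia].
move=> {n flag t rest} flag t rest.
have Hx := @calls_gadgetY W D t 0 0 _ W_gt0 W_gt0.
eapply evals_eq; [ev| |].
  rewrite /blockY /coreY -!catA !prepend_cat -/S -/g.
  by do ![apply: (f_equal2 prepend); first by [|congr nseq; lia]].
have := gain_le_scale W D; have := base_scale W D; have := base_ge W D.
rewrite -/S /g /null_gain -/S !expnS expn0; lia.
Qed.
End Enumerators.
End Library.

(** * The main program and its running time *)

Definition growthE e :=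
  let e2 := F_app @(e, e) in
  F_mul @(succE (succE e2), F_mul @(succE (F_app @(e2, e2)), sepE e)).
Definition scale0E e :=
  F_mul @(succE (succE (F_app @(e, e))), succE (succE (succE (succE e)))).

Definition singletonE := ENode trueE ELeaf.

(* [thr] computes the threshold from variable 0 (one more than the gain of an
   unsatisfiable instance), 1 (the padding) and 3 (the unpadded first sequence).
   The successive [ELet]s bind the depth, the scales, [null_gain], the layers,
   [S m], [512 (S m)], the unpadded first sequence, the second sequence, the
   padding, and the gain. *)
Definition body_main (thr : expr) :=
  ECase (argE 0 1) ELeaf (ECase (EVar 1)
    (ENode singletonE (ENode singletonE ELeaf))
    (ELet (ECall F_lg (EVar 3))
    (ELet (F_scales @(EVar 0, growthE (argE 5 2), scale0E (argE 5 2), ELeaf))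
    (ELet (F_app @(fstE (EVar 0), ECall F_gain (sndE (EVar 0))))
    (ELet (fstE (F_build @(EVar 2, restE 7 3)))
    (ELet (F_shl @(ECall F_half (succE (argE 8 0)), fstE (EVar 2)))
    (ELet (F_shl @(litE 9, EVar 0))
    (let enumE e := F_enumX @(argE 10 0, trueE, EVar 2, EVar 5, fstE (EVar 4), EVar 3,
       sndE (EVar 4), argE 10 2, e) in
    ELet (enumE (enumE (enumE (F_app @(EVar 0, F_rep1 @(EVar 0, ELeaf))))))
    (ELet (F_app @(F_shl @(litE 6, EVar 2),
       F_enumY @(argE 11 0, ELeaf, EVar 3, EVar 6, fstE (EVar 5), EVar 4,
         sndE (EVar 5), argE 11 2,
         F_app @(F_shl @(litE 6, EVar 2), F_app @(EVar 1, F_rep1 @(EVar 1, ELeaf))))))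
    (ELet (ECall F_len (F_drop @(EVar 0, EVar 1)))
    (ELet (succE (F_app @(F_shl @(ECall F_half (argE 13 0), EVar 6), EVar 3)))
    (ENode (F_app @(EVar 3, EVar 1)) (ENode (EVar 2) thr))))))))))))).

Definition thr_lcs := F_app @(ECall F_zeros (EVar 3), EVar 0).
Definition thr_edit := F_drop @(F_app @(ECall F_ones (EVar 3), F_app @(EVar 1, EVar 1)), EVar 0).

#[local] Hint Resolve calls_app_nat | 1 : calls.
#[local] Hint Resolve calls_app_rep0 | 2 : calls.
#[local] Hint Resolve calls_app_bits calls_mul calls_shl calls_half calls_rep1 calls_gain
  calls_build calls_zeros calls_ones calls_len calls_drop calls_drop_nat : calls.

Section Main.
Variables (thr : expr) (n T W : nat) (P : bp n T.+2 W.+1).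
Let main := body_main thr.
Let D := lg T.+1.
Let w := W.+1.
Let S := scale w D.
Let m := 2 ^ n.+1./2.
Let A := S * m.
Let t0 := layers_tree P D.
Let ts := enum_half D true n t0.
Let us := enum_half D false n t0.
Let X := unpaddedX w D m ts.
Let Y := instanceY w D m us.
Let g := size us * null_gain w D + 1 + 512 * A.
Let pad := padding w D m ts us.

Lemma depth_gt0 : 0 < D. Proof. by rewrite /D lgE. Qed.

(** Work on a tree of layers, which has [2 ^ D] leaves, is charged to [S]. The next lemmas likewise
    bound all other parameters by [S] or [A]. *)
Lemma pow2_depth : 2 ^ D <= S.
Proof.
rewrite /S /scale /base mulnA; apply: leq_trans (leq_pmull _ _); last by lia.
by rewrite leq_exp2r ?depth_gt0 //; have := growth_ge w; lia.
Qed.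

Lemma length_scale : T.+1 <= S.
Proof. by have := pow2_depth; have := lg_bounds T.+1; rewrite -/D; lia. Qed.

Lemma growth_scale : growth w <= S.
Proof.
rewrite /S /scale /base mulnA; apply: leq_trans (leq_pmull _ _); last by lia.
by rewrite -{1}(expn1 (growth w)) leq_pexp2l ?depth_gt0 //; have := growth_ge w; lia.
Qed.

Lemma scale0_scale : scale w 0 <= S.
Proof. by rewrite /S /scale /base !leq_mul2l leq_pexp2l ?orbT //; have := growth_ge w; lia. Qed.

Lemma scale_ge8 : 8 <= S.
Proof. have := base_ge w D; have := base_scale w D; rewrite -/S; lia. Qed.

Lemma vars_le : n.+1 <= 2 * m.
Proof. have : n.+1./2 < m by apply: ltn_expl. by lia. Qed.

Lemma scale_le_unit : S <= A. Proof. by rewrite leq_pmulr // expn_gt0. Qed.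
Lemma halves_le_unit : m <= A. Proof. by rewrite leq_pmull //; have := scale_ge8; lia. Qed.

Variable tv : nat.
Hypothesis thr_evals : forall env,
  evals main [:: tree_of_nat g, tree_of_nat pad, prepend Y Leaf, prepend X Leaf & env]
    thr (tree_of_nat tv) (100 * (1200 * A)).

Lemma size_ts : size ts = m. Proof. by rewrite size_enum_half addn1. Qed.
Lemma size_us : size us = 2 ^ n./2. Proof. by rewrite size_enum_half addn0. Qed.
Lemma size_us_le : size us <= m.
Proof. by rewrite size_us leq_exp2l // half_leq. Qed.

Lemma evals_let env e1 e2 v1 v v1' K1 K1' K2 K : evals main env e1 v1' K1' -> v1' = v1 ->
  K1' <= K1 -> evals main (v1 :: env) e2 v K2 -> K1 + K2 + 1 <= K -> evals main env (ELet e1 e2) v K.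
Proof.
by move=> H1 Ev le1 H2 le; apply: evals_eq (ev_let (evals_eq H1 Ev le1) H2) _ _.
Qed.

Ltac bind v K := eapply (@evals_let _ _ _ v _ _ K); [ev| | | |].

Lemma size_X : size X <= 1072 * A.
Proof. by have := size_unpaddedX w D size_ts; rewrite -/X -/S -/A; lia. Qed.

Lemma size_Y : size X <= size Y <= 1200 * A.
Proof.
have : size us * (33 * S + null_gain w D + len_gadgetY w D) <= m * (36 * S).
  apply: leq_mul; first exact: size_us_le.
  by rewrite /null_gain -/S; have := gain_le_scale w D; have := len_le_scale w D; rewrite -/S; lia.
have := size_X; rewrite size_instanceY -/S -/A; have : m * (36 * S) = 36 * A by rewrite /A; lia.
lia.
Qed.

Lemma calls_main : calls main 0 (tree_of_bp P)
  (tree_of_instance (instanceX w D m ts us) Y tv) (1000 * (1000 * A)).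
Proof.
have S8 := scale_ge8; have mge := vars_le; have SA := scale_le_unit; have mA := halves_le_unit.
have DS := pow2_depth; have TS := length_scale; have GS := growth_scale.
have S0 := scale0_scale.
have sX := size_X; have /andP [sXY sY] := size_Y.
have bS : 2 * base w D <= S := base_scale w D.
have gS : 2 * gain w D <= S := gain_le_scale w D.
have Hlg := calls_lg main T.+1; rewrite tree_of_natS -/D in Hlg.
have Hsc : calls main F_scales (Node (tree_of_nat D)
    (Node (tree_of_nat ((w + w).+2 * ((w + w + (w + w)).+1 * (w + w).+1.+4)))
      (Node (tree_of_nat ((w + w).+2 * w.+4)) Leaf)))
    (Node (tree_of_nat S) (scales_tree w D)) (400 * S + 100).
  apply: calls_eq _ _ (leqnn _); last by [].
  have -> : (w + w).+2 * ((w + w + (w + w)).+1 * (w + w).+1.+4) = growth w.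
    by rewrite /growth; congr (_ * (_ * _)); lia.
  have -> : (w + w).+2 * w.+4 = scale w 0.
    by rewrite /scale /base expn0 muln1; congr (_ * _); lia.
  by apply: calls_eq (calls_scales main w D 0) _ _; rewrite ?add0n //; lia.
(* Each half assignment costs a constant times [S], and there are at most [m] of them. *)
have costE : m * (4000 * S + 4 * (200 * 2 ^ D + 300) + 10) <= 5 * (1000 * A).
  rewrite /A; move: DS S8; move: S (2 ^ D) => s p Ds s8.
  by rewrite (mulnC s) !(mulnCA _ m) leq_mul2l; lia.
have HX rest : calls main F_enumX (Node (tree_of_nat n) (Node (Node Leaf Leaf) (Node t0
    (Node (tree_of_nat D) (Node (tree_of_nat S) (Node (tree_of_nat (null_gain w D))
      (Node (scales_tree w D) (Node (tree_of_nat w) rest))))))))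
    (prepend (listX w D ts) rest) (5 * (1000 * A)).
  apply: calls_eq (calls_enumX main D (ltn0Sn W) n true t0 rest) _ _ => //.
  by rewrite addn1.
have HY rest : calls main F_enumY (Node (tree_of_nat n) (Node Leaf (Node t0
    (Node (tree_of_nat D) (Node (tree_of_nat S) (Node (tree_of_nat (null_gain w D))
      (Node (scales_tree w D) (Node (tree_of_nat w) rest))))))))
    (prepend (listY w D us) rest) (5 * (1000 * A)).
  apply: calls_eq (calls_enumY main D (ltn0Sn W) n false t0 rest) _ _ => //.
  by rewrite addn0; apply: leq_trans costE; rewrite leq_mul2r leq_exp2l // half_leq ?orbT.
apply: (@calls_body _ _ (body_main thr)) => //.
rewrite /body_main /tree_of_bp tree_of_natS tree_of_natS -/w.
pose L := tree_of_seq [seq layer_tree P i | i <- enum 'I_T.+1].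
rewrite -[tree_of_seq _]/L.
eapply evals_eq.
- eapply ev_case; [ev|cbn beta iota].
  eapply ev_case; [ev|cbn beta iota].
  bind (tree_of_nat D) (300 * S).
  + by [].
  + lia.
  unfold growthE, scale0E.
  bind (Node (tree_of_nat S) (scales_tree w D)) (3000 * S).
  + by [].
  + have w0 : 0 < w by [].
    (* [Q] is the inner product in [growthE]; [F1] to [F4] bound the unary multiplications by
       [growth w] and [scale w 0], both at most [S]. *)
    pose Q := (w + w + (w + w)).+1 * (w + w).+1.+4.
    have Q7 : (w + w + (w + w)).+2 * (w + w).+2.+4 <= 2 * Q by rewrite /Q; nia.
    have Q35 : 35 <= Q by rewrite /Q; nia.
    have gQ : growth w = (w + w).+2 * Q by rewrite /growth /Q; congr (_ * (_ * _)); lia.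
    have F1 : (w + w).+3 * Q.+1 <= 2 * growth w by rewrite gQ; move: (Q) Q35 => q q35; nia.
    have F2 : Q <= growth w by rewrite gQ leq_pmull.
    have E0 : scale w 0 = (2 * w + 2) * (w + 4) by rewrite /scale /base expn0 muln1.
    have F3 : (w + w).+3 * w.+4.+1 <= 2 * scale w 0 by rewrite E0; nia.
    have F4 : w <= scale w 0 by rewrite E0; nia.
    move: F1 F2 F3 F4 Q7 GS S0 S8; rewrite -/Q {gQ E0 Q35}.
    move: (scale w 0) (growth w) (S) (Q) (w) => ? ? ? ? ?.
    lia.
  bind (tree_of_nat (null_gain w D)) (200 * S).
  + by [].
  + lia.
  bind t0 (300 * S).
  + by [].
  + lia.
  bind (tree_of_nat A) (300 * A).
  + by [].
  + lia.
  bind (tree_of_nat (512 * A)) (60 * (2000 * A)).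
  + by congr tree_of_nat; rewrite mulnC; congr (_ * _).
  + by rewrite !expnS expn0; lia.
  bind (prepend X Leaf) (50 * (1000 * A)).
  + by rewrite -!prepend_cat /X /unpaddedX !listX_cat -!catA.
  + lia.
  bind (prepend Y Leaf) (100 * (1000 * A)).
  + have -> : A * 2 ^ 6 = 64 * A by rewrite !expnS expn0; lia.
    by rewrite -!prepend_cat /Y /instanceY nseqD -!catA.
  + by rewrite !expnS expn0; lia.
  bind (tree_of_nat pad) (100 * (1200 * A)).
  + by rewrite size_drop.
  + by rewrite size_drop; lia.
  bind (tree_of_nat g) (400 * A).
  + by congr tree_of_nat; rewrite /g size_us; lia.
  + have : null_gain w D * 2 ^ n./2 <= 2 * A.
      by rewrite /A mulnA leq_mul ?leq_exp2l ?half_leq // /null_gain -/S; lia.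
    have : (null_gain w D).+1 * 2 ^ n./2 <= 3 * A.
      by rewrite /A mulnA leq_mul ?leq_exp2l ?half_leq // /null_gain -/S; lia.
    lia.
  eapply ev_node; first by ev.
  by eapply ev_node; [ev|apply: thr_evals].
  1-10: apply: leqnn.
- by rewrite /tree_of_instance !tree_of_bitsE tree_of_natE -prepend_cat.
- lia.
Qed.
End Main.

(** * Length bound and conclusion *)

Definition instance_size n T W := if T is T'.+2 then
    let d := lg T'.+1 in
    1152 * (scale W d * 2 ^ n.+1./2) + 2 ^ n./2 * (33 * scale W d + null_gain W d + len_gadgetY W d)
  else 1.

(** The factor 2 on the left will pay for rounding [n / 2] up. All constants become powers of
    [maxn 2 W], which is at least 2. *)
Lemma instance_size_le n T W : 1 < T -> 0 < W ->
  2 * instance_size n T W <= 2 ^ n.+1./2 * maxn 2 W ^ (lg T.-1 * 29).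
Proof.
case: T => [|[|T]] // _ W0; rewrite /instance_size [T.+2.-1]/=; set D := lg T.+1.
have W2 : 2 <= maxn 2 W by rewrite leq_maxl.
have WW : W <= maxn 2 W by rewrite leq_maxr.
have D0 : 0 < D by rewrite /D lgE.
move: (maxn 2 W) W2 WW => w w2 Ww.
have le : scale W D <= w ^ 6 * w ^ (11 * D).
  rewrite /scale /base mulnA expnM.
  have p1 : 2 * W + 2 <= w ^ 3 by rewrite !expnS expn0; nia.
  have p2 : W + 4 <= w ^ 3 by rewrite !expnS expn0; nia.
  have p3 : 4 * W + 1 <= w ^ 4 by rewrite !expnS expn0; nia.
  have p4 : 2 * W + 5 <= w ^ 4 by rewrite !expnS expn0; nia.
  apply: leq_mul; first by rewrite (expnD w 3 3); apply: leq_mul.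
  by rewrite leq_exp2r // /growth (expnD w 3 8) (expnD w 4 4); do 2!apply: leq_mul => //.
have sz : 1152 * (scale W D * 2 ^ n.+1./2) + 2 ^ n./2 * (33 * scale W D + null_gain W D + len_gadgetY W D)
    <= 2 ^ 11 * (2 ^ n.+1./2 * scale W D).
  have : 2 ^ n./2 * (33 * scale W D + null_gain W D + len_gadgetY W D) <=
      2 ^ n.+1./2 * (36 * scale W D).
    apply: leq_mul; first by rewrite leq_exp2l // half_leq.
    by rewrite /null_gain; have := gain_le_scale W D; have := len_le_scale W D; lia.
  have -> : 2 ^ 11 = 2048 by [].
  by move: (2 ^ n.+1./2) (scale W D) => m S; lia.
(* 29 = 12 + 6 + 11: twelve powers for the constant, six for the prefactor of [scale], eleven for
   [growth]; [D0] allows multiplying the first two by [D]. *)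
have up : 2 * (2 ^ 11 * (w ^ 6 * w ^ (11 * D))) <= w ^ (D * 29).
  have -> : w ^ (D * 29) = w ^ (18 * D) * w ^ (11 * D) by rewrite -expnD; congr (w ^ _); lia.
  have c2 : 2 * 2 ^ 11 <= w ^ 12.
    by apply: (@leq_trans (2 ^ 12)); [|rewrite leq_exp2r].
  move: (2 ^ 11) c2 => c c2; rewrite (mulnA c) (mulnA 2) (mulnA 2) leq_mul2r; apply/orP; right.
  apply: (@leq_trans (w ^ 18)); last by rewrite leq_pexp2l //; lia.
  have -> : w ^ 18 = w ^ 12 * w ^ 6 by rewrite -expnD.
  by rewrite leq_mul2r c2 orbT.
apply: leq_trans (leq_mul (leqnn 2) sz) _.
rewrite (mulnCA (2 ^ 11)) mulnCA leq_mul2l; apply/orP; right.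
by apply: leq_trans up; rewrite !leq_mul2l /= le.
Qed.

(** * The length bound over the reals *)

Section NumericBound.
Import Order.TTheory GRing.Theory Num.Theory.
Local Open Scope ring_scope.

Lemma instance_size_bound (R : realType) n T W : (0 < T)%N -> (0 < W)%N ->
  ((instance_size n T W)%:R <= 2 `^ (n%:R / 2)
     * T%:R `^ (58%:R * (ln (maxn 2 W)%:R / ln 2)) :> R).
Proof.
have ge1 (a : R) x : 1 <= a -> 0 <= x -> 1 <= a `^ x.
  by move=> a1 x0; rewrite -(powRr0 a); apply: ler_powR.
have w2 : (2 <= maxn 2 W)%N by rewrite leq_maxl.
have ln2 : 0 < ln 2 :> R by rewrite ln_gt0 // ltr1n.
have wR : 2 <= (maxn 2 W)%:R :> R by rewrite ler_nat.
set L := ln (maxn 2 W)%:R / ln 2.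
have L0 : 0 <= L.
  by apply: divr_ge0 (ltW ln2); apply: ln_ge0; apply: le_trans wR; rewrite ler1n.
have Lw : 2 `^ L = (maxn 2 W)%:R :> R.
  rewrite /powR pnatr_eq0 /= /L divfK ?gt_eqF // lnK // posrE.
  by rewrite (lt_le_trans _ wR).
move=> T0 W0; have [T1|T1] := leqP T 1.
  have -> : T = 1%N by lia.
  rewrite /= powR1 mulr1; apply: ge1; first by rewrite ler1n.
  by rewrite divr_ge0.
have /(_ n) := instance_size_le _ T1 W0; rewrite -(ler_nat R) !natrM !natrX => le.
have hm : (2 ^+ n.+1./2 : R) <= 2 * 2 `^ (n%:R / 2).
  rewrite -powR_mulrn // -{2}(powRr1 (a := 2)) // -powRD ?pnatr_eq0 ?implybT //.
  apply: ler_powR; first by rewrite ler1n.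
  have : (n.+1./2 * 2 <= 2 + n)%N by lia.
  rewrite -(ler_nat R) natrM natrD; lra.
(* 58 = 2 * 29, because [2 ^ lg T.-1] is at most [2 * T.-1], hence at most the square of [T]. *)
have hw : (maxn 2 W)%:R ^+ (lg T.-1 * 29) <= T%:R `^ (58%:R * L) :> R.
  have -> : (maxn 2 W)%:R ^+ (lg T.-1 * 29) = ((2 ^+ lg T.-1) `^ L) ^+ 29 :> R.
    by rewrite exprM -Lw -(powR_mulrn _ (powR_ge0 _ _)) powRAC powR_mulrn.
  have -> : 58%:R * L = 2 * L * 29%:R by lra.
  rewrite powRrM powR_mulrn ?powR_ge0 //; apply: lerXn2r; rewrite ?nnegrE ?powR_ge0 //.
  rewrite powRrM; apply: ge0_ler_powR; rewrite ?nnegrE ?powR_ge0 ?exprn_ge0 //.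
  rewrite powR_mulrn // -!natrX ler_nat.
  by have := lg_bounds T.-1; nia.
rewrite -(ler_pM2l (ltr0n R 2)); apply: le_trans le _.
rewrite mulrA; apply: ler_pM => //; rewrite ?exprn_ge0 //.
Qed.
End NumericBound.

(** * Thresholds for LCS and edit distance *)

Section Instance.
Variables (n T W : nat) (P : bp n T.+2 W.+1).
Let d := lg T.+1.
Let m := 2 ^ n.+1./2.
Let ts := enum_half d true n (layers_tree P d).
Let us := enum_half d false n (layers_tree P d).

Definition seqX := instanceX W.+1 d m ts us.
Definition seqY := instanceY W.+1 d m us.
Definition baseX := unpaddedX W.+1 d m ts.
Definition pads := padding W.+1 d m ts us.
Definition sat_gain := size us * null_gain W.+1 d + 1 + 512 * (scale W.+1 d * m).

Lemma size_seqY : size seqY = instance_size n T.+2 W.+1.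
Proof. by rewrite size_instanceY /us size_us. Qed.

Lemma size_baseX : size baseX + pads = size seqY.
Proof. by rewrite subnKC //; have /andP [] := size_Y P. Qed.

Lemma size_seqX : size seqX = instance_size n T.+2 W.+1.
Proof. by rewrite -size_seqY -size_baseX size_cat size_nseq. Qed.

Lemma zeros_seqX : zeros seqX = zeros baseX + pads.
Proof. by rewrite count_cat zeros_rep0. Qed.

Lemma sat_align beta : beta <= 1 -> bp_sat P <->
  exists g l, align beta seqX seqY g l /\ sat_gain + l <= g + pads * beta.+1.
Proof.
move=> lebeta; have leT : T.+1 <= 2 ^ d by have /andP [/ltnW] := lg_bounds T.+1.
have := @instance_correct W.+1 d beta m ts us lebeta (size_ts P) (size_us_le P).
exact: iff_trans (sat_reach P leT).
Qed.

Lemma sat_lcs : bp_sat P <-> zeros baseX + sat_gain <= lcs seqX seqY.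
Proof.
apply: iff_trans (sat_align (leq0n 1)) _; apply: iff_trans _ (iff_sym (lcs_geP _ _ _)).
by split=> [[g [l [H le]]]|[g [l [H le]]]]; exists g, l; split=> //;
  move: le; rewrite zeros_seqX; lia.
Qed.

(** Makes the truncated subtraction in the edit distance threshold exact. *)
Lemma sat_gain_le : sat_gain <= ones baseX + (pads + pads).
Proof.
have le : size us * null_gain W.+1 d + 1 <= ones (listX W.+1 d (ts ++ ts ++ ts)).
  have H l : size l * null_gain W.+1 d <= ones (listX W.+1 d l).
    elim: l => //= t l IH; rewrite /listX /= !count_repE -/(listX _ _ l); lia.
  apply: leq_trans (H _); rewrite !size_cat (size_ts P) -/m.
  have := size_us_le P; rewrite -/us -/m => leu.
  have m0 : 0 < m by rewrite expn_gt0.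
  have g0 : 0 < null_gain W.+1 d by rewrite addn_gt0 scale_gt0.
  have := leq_mul leu (leqnn (null_gain W.+1 d)); nia.
rewrite /baseX /unpaddedX !count_repE /sat_gain; lia.
Qed.

(** The padding adds [pads] to both [size seqY - size baseX] and [zeros seqX], which cancels;
    [pads + pads] is the loss of the final zeros for [beta = 1]. *)
Lemma sat_edit : bp_sat P <->
  edit_distance seqX seqY <= ones baseX + (pads + pads) - sat_gain.
Proof.
apply: iff_trans (sat_align (leqnn 1)) _; apply: iff_trans _ (iff_sym (edit_distance_leP _ _ _)).
have := sat_gain_le; have := size_baseX; have := zerosD_ones baseX.
by move=> E1 E2 le0; split=> [[g [l [H le]]]|[g [l [H le]]]]; exists g, l; split=> //;
  move: le; rewrite zeros_seqX; lia.
Qed.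

Lemma evals_lcs env :
  evals (body_main thr_lcs) [:: tree_of_nat sat_gain, tree_of_nat pads, prepend seqY Leaf,
    prepend baseX Leaf & env] thr_lcs (tree_of_nat (zeros baseX + sat_gain))
    (100 * (1200 * (scale W.+1 d * m))).
Proof.
have sX := size_X P; have S8 := scale_ge8 P; have SA := scale_le_unit n T W.
have zX := zeros_le baseX.
rewrite /thr_lcs; eapply evals_eq; [ev|by []|].
rewrite -/baseX -/d -/m in sX S8 SA *; lia.
Qed.

Lemma evals_edit env :
  evals (body_main thr_edit) [:: tree_of_nat sat_gain, tree_of_nat pads, prepend seqY Leaf,
    prepend baseX Leaf & env] thr_edit
    (tree_of_nat (ones baseX + (pads + pads) - sat_gain))
    (100 * (1200 * (scale W.+1 d * m))).
Proof.
have sX := size_X P; have S8 := scale_ge8 P; have SA := scale_le_unit n T W.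
have /andP [_ sY] := size_Y P; have sXY := size_baseX.
have zX := ones_le baseX.
rewrite /thr_edit; eapply evals_eq; [ev|by []|].
have gle : sat_gain <= 600 * (scale W.+1 d * m).
  have := size_us_le P; rewrite -/us -/m => leu.
  have : null_gain W.+1 d <= 2 * scale W.+1 d.
    by rewrite /null_gain; have := gain_le_scale W.+1 d; lia.
  move/(leq_mul leu); rewrite /sat_gain; rewrite -/d -/m in S8 SA *; lia.
rewrite -/baseX -/seqY -/d -/m in sX sY S8 SA *; lia.
Qed.
End Instance.

Lemma calls_runs main input output K : calls main 0 input output K ->
  exists2 k, runs_in (main :: library) input output k & k <= K + 2.
Proof.
move=> H; have H0 : evals main [:: input] (EVar 0) input 1 by apply: ev_var.
by have [k Hk le] := ev_call H0 H; exists k => //; lia.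
Qed.

Lemma reduction (R : realType) good thr (tv : forall n T W, bp n T.+2 W.+1 -> nat) :
  good [:: true] [:: true] 0 ->
  (forall n T W (P : bp n T.+2 W.+1), bp_sat P <-> good (seqX P) (seqY P) (tv n T W P)) ->
  (forall n T W (P : bp n T.+2 W.+1) env,
    evals (body_main thr) [:: tree_of_nat (sat_gain P), tree_of_nat (pads P),
      prepend (seqY P) Leaf, prepend (baseX P) Leaf & env] thr (tree_of_nat (tv n T W P))
    (100 * (1200 * (scale W.+1 (lg T.+1) * 2 ^ n.+1./2)))) ->
  bp_sat_reduces_to R good.
Proof.
move=> good1 correct thrP.
exists (body_main thr :: library), instance_size, (1000 * 10), 58.
split=> [n T W T0 W0|n [|T] W P]; first exact: instance_size_bound.
  (* With a single layer the start node is the accept node, so a fixed positive instance is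
     returned. *)
  have : calls (body_main thr) 0 (tree_of_bp P) (tree_of_instance [:: true] [:: true] 0) 100.
    apply: (@calls_body _ _ (body_main thr)) => //.
    rewrite /tree_of_bp tree_of_natS tree_of_nat0 /body_main.
    eapply evals_eq; first by ev; unfold singletonE; ev.
      by rewrite /tree_of_instance !tree_of_bitsE tree_of_nat0.
    by [].
  case/calls_runs=> k Hk lek; exists [tuple true], [tuple true], 0, k; split.
  - exact: Hk.
  - by rewrite /instance_size; lia.
  - split=> // _; exists (nseq_tuple n false); rewrite /bp_accepts.
    suff -> : bp_start 0 W = bp_acc 0 W by apply: connect0.
    by congr pair; apply: val_inj.
have [k Hk lek] := calls_runs (calls_main (thrP n T W P)).
exists (Tuple (introT eqP (size_seqX P))), (Tuple (introT eqP (size_seqY P))), (tv n T W P), k.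
split; last exact: correct.
- exact: Hk.
(* The time is at most [1000 * 1000] units [S * m] plus 2, while the length is at least 1152
   units. *)
- apply: leq_trans lek _.
  have := scale_ge8 P; have := scale_le_unit n T W; rewrite /instance_size.
  by lia.
Qed.

Theorem theorem1 (R : realType) :
  bp_sat_reduces_to R (fun x y t => (edit_distance x y <= t)%N) /\
  bp_sat_reduces_to R (fun x y t => (t <= lcs x y)%N).
Proof.
split.
- apply: (@reduction R _ thr_edit (fun n T W P => ones (baseX P) + (pads P + pads P) - sat_gain P)).
  + by apply/edit_distance_leP; exists 1, 0; split=> //; apply: align_self.
  + by move=> n T W P; apply: sat_edit.
  + by move=> *; apply: evals_edit.
- apply: (@reduction R _ thr_lcs (fun n T W P => zeros (baseX P) + sat_gain P)) => //.
  + by move=> n T W P; apply: sat_lcs.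
  + by move=> *; apply: evals_lcs.
Qed.
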